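(* Consider problem $\min_{\mathbf x\in\mathbb R^n}F(\mathbf x)=\sum_{i=1}^I f_i(\mathbf x)$ where each $f_i$ is proper, closed and $L_i$-Lipschitz differentiable (possibly nonconvex) and $F$ is bounded from below. Let $\{(\mathbf x_i^k)_{i=1}^I\}_k$ be generated by ASY-SONATA (as in the context) with constant step-size $\gamma^k\equiv\gamma$. For $\delta>0$ let $T_\delta$ be the first $k\in\mathbb N_0$ with $M_F(\mathbf x^k)\le\delta$. Then there exists $\bar\gamma_2>0$ such that for every $\gamma\in(0,\bar\gamma_2)$, $T_\delta=\mathcal O(1/\delta)$.
   Context: Graph: $\mathcal G=(\mathcal V,\mathcal E)$, $\mathcal V=\{1,\dots,I\}$, strongly connected digraph without self-loops; $\mathcal N_i^{\rm in}=\{j:(j,i)\in\mathcal E\}$, $\mathcal N_i^{\rm out}=\{j:(i,j)\in\mathcal E\}$. Weight matrices $W=(w_{ij})$ (row-stochastic) and $A=(a_{ij})$ (column-stochastic) satisfy, for some $\bar m\in(0,1)$: diagonal entries $\ge\bar m$, entries $(i,j)$ with $(j,i)\in\mathcal E$ are $\ge\bar m$, all other entries $0$. Asynchrony model: $(i^k,\mathbf d^k)_{k\in\mathbb N_0}$, $i^k\in\mathcal V$, $\mathbf d^k=(d_j^k)_{j\in\mathcal N^{\rm in}_{i^k}}$, with every agent appearing among $i^k,\dots,i^{k+T-1}$ for all $k$ and $0\le d_j^k\le D$. ASY-SONATA: initialization $\mathbf x_i^0\in\mathbb R^n$, $\mathbf z_i^0=\nabla f_i(\mathbf x_i^0)$,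 $\tilde{\boldsymbol\rho}_{ij}^0=0$, $\tau_{ij}^{-1}=-D$, and $\boldsymbol\rho_{ij}^t=0$, $\mathbf v_i^t=0$ for $t=-D,\dots,0$. At iteration $k$ with $i=i^k$: (1) $\tau_{ij}^k=\max(\tau_{ij}^{k-1},k-d_j^k)$, $j\in\mathcal N_i^{\rm in}$; (2) $\mathbf v_i^{k+1}=\mathbf x_i^k-\gamma^k\mathbf z_i^k$; (3) $\mathbf x_i^{k+1}=w_{ii}\mathbf v_i^{k+1}+\sum_{j\in\mathcal N_i^{\rm in}}w_{ij}\mathbf v_j^{\tau_{ij}^k}$; (4) $\mathbf z_i^{k+1/2}=\mathbf z_i^k+\sum_{j\in\mathcal N_i^{\rm in}}(\boldsymbol\rho_{ij}^{\tau_{ij}^k}-\tilde{\boldsymbol\rho}_{ij}^k)+\nabla f_i(\mathbf x_i^{k+1})-\nabla f_i(\mathbf x_i^k)$; (5) $\mathbf z_i^{k+1}=a_{ii}\mathbf z_i^{k+1/2}$ and $\boldsymbol\rho_{ji}^{k+1}=\boldsymbol\rho_{ji}^k+a_{ji}\mathbf z_i^{k+1/2}$ for $j\in\mathcal N_i^{\rm out}$; (6) $\tilde{\boldsymbol\rho}_{ij}^{k+1}=\boldsymbol\rho_{ij}^{\tau_{ij}^k}$ for $j\in\mathcal N_i^{\rm in}$; (7) all other variables keep their values. Merit function: with $\mathbf x^k=[\mathbf x_1^{k\top},\dots,\mathbf x_I^{k\top}]^\top$ and $\bar{\mathbf x}^k=\frac1I\sum_i\mathbf x_i^k$, $M_F(\mathbf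 x^k)=\max\{\|\nabla F(\bar{\mathbf x}^k)\|^2,\|\mathbf x^k-\mathbf 1_I\otimes\bar{\mathbf x}^k\|^2\}$. *)

(* Defs.v *)
From mathcomp Require Import all_boot.
From Stdlib Require Import Reals ZArith.
Set Implicit Arguments.
Unset Strict Implicit.
Unset Printing Implicit Defensive.
Open Scope R_scope.

Definition vec (n : nat) := 'I_n -> R.
Definition vzero {n} : vec n := fun _ => 0.
Definition vadd {n} (u w : vec n) : vec n := fun l => u l + w l.
Definition vsub {n} (u w : vec n) : vec n := fun l => u l - w l.
Definition vscale {n} (a : R) (u : vec n) : vec n := fun l => a * u l.
Definition vsum {n} {T : finType} (P : pred T) (F : T -> vec n) : vec n :=
  fun l => \big[Rplus/0]_(t | P t) F t l.
Definition dot {n} (u w : vec n) : R := \big[Rplus/0]_(l < n) (u l * w l).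
Definition sqnorm {n} (u : vec n) : R := dot u u.
Definition norm {n} (u : vec n) : R := sqrt (sqnorm u).

Definition has_gradient {n} (f : vec n -> R) (g : vec n -> vec n) : Prop :=
  forall (x : vec n) (eps : R), 0 < eps -> exists del : R, 0 < del /\
    forall h : vec n, norm h < del ->
      Rabs (f (vadd x h) - f x - dot (g x) h) <= eps * norm h.

Definition lipschitz_differentiable {n} (f : vec n -> R) (g : vec n -> vec n) (L : R) :=
  has_gradient f g /\ 0 <= L /\ forall x y, norm (vsub (g x) (g y)) <= L * norm (vsub x y).

(* Strongly connected digraph without self-loops; E j i means (j,i) is an edge. *)
Definition strongly_connected {I : nat} (E : rel 'I_I) : Prop :=
  forall i j : 'I_I, Relation_Operators.clos_refl_trans _ (fun a b => E a b) i j.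
Definition no_self_loops {I : nat} (E : rel 'I_I) : Prop := forall i, ~~ E i i.

Definition weight_pattern {I : nat} (E : rel 'I_I) (mbar : R) (M : 'I_I -> 'I_I -> R) :=
  (forall i, mbar <= M i i) /\
  (forall i j, E j i -> mbar <= M i j) /\
  (forall i j, i != j -> ~~ E j i -> M i j = 0).
Definition row_stochastic {I : nat} (M : 'I_I -> 'I_I -> R) :=
  (forall i j, 0 <= M i j) /\ forall i, \big[Rplus/0]_(j < I) M i j = 1.
Definition col_stochastic {I : nat} (M : 'I_I -> 'I_I -> R) :=
  (forall i j, 0 <= M i j) /\ forall j, \big[Rplus/0]_(i < I) M i j = 1.

(* Asynchrony model: act k = i^k, d k j = d_j^k (relevant for j in N_in(i^k)). *)
Definition asynchrony_model {I : nat} (E : rel 'I_I) (T D : nat)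
  (act : nat -> 'I_I) (d : nat -> 'I_I -> nat) : Prop :=
  (forall (k : nat) (i : 'I_I), exists t : nat, (k <= t < k + T)%nat /\ act t = i) /\
  (forall (k : nat) (j : 'I_I), E j (act k) -> (d k j <= D)%nat).

Definition tau_prev {I : nat} (D : nat) (tau : nat -> 'I_I -> 'I_I -> Z) (k : nat) i j : Z :=
  match k with O => (- Z.of_nat D)%Z | S k' => tau k' i j end.

Definition zhalf {n I : nat} (E : rel 'I_I) (g : 'I_I -> vec n -> vec n)
  (x z : nat -> 'I_I -> vec n) (rho : Z -> 'I_I -> 'I_I -> vec n)
  (rt : nat -> 'I_I -> 'I_I -> vec n) (tau : nat -> 'I_I -> 'I_I -> Z)
  (k : nat) (i : 'I_I) : vec n :=
  vadd (vadd (z k i)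
             (vsum (fun j => E j i) (fun j => vsub (rho (tau k i j) i j) (rt k i j))))
       (vsub (g i (x k.+1 i)) (g i (x k i))).

(* The ASY-SONATA recursion with constant step-size gam.
   Index conventions: x, z, rt (= rho tilde), tau indexed by k : nat;
   v and rho indexed by times t : Z (t >= -D). *)
Definition asy_sonata {n I : nat} (E : rel 'I_I) (W A : 'I_I -> 'I_I -> R) (D : nat)
  (g : 'I_I -> vec n -> vec n) (gam : R)
  (act : nat -> 'I_I) (d : nat -> 'I_I -> nat)
  (x z : nat -> 'I_I -> vec n) (v : Z -> 'I_I -> vec n)
  (rho : Z -> 'I_I -> 'I_I -> vec n) (rt : nat -> 'I_I -> 'I_I -> vec n)
  (tau : nat -> 'I_I -> 'I_I -> Z) : Prop :=
  (forall i, z 0%nat i = g i (x 0%nat i)) /\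
  (forall i j, rt 0%nat i j = vzero) /\
  (forall t i j, (- Z.of_nat D <= t <= 0)%Z -> rho t i j = vzero) /\
  (forall t i, (- Z.of_nat D <= t <= 0)%Z -> v t i = vzero) /\
  (forall k i j, E j i ->
     tau k i j = if i == act k
                 then Z.max (tau_prev D tau k i j) (Z.of_nat k - Z.of_nat (d k j))%Z
                 else tau_prev D tau k i j) /\
  (forall k i, v (Z.of_nat k + 1)%Z i =
     if i == act k then vsub (x k i) (vscale gam (z k i)) else v (Z.of_nat k) i) /\
  (forall k i, x k.+1 i =
     if i == act k
     then vadd (vscale (W i i) (v (Z.of_nat k + 1)%Z i))
               (vsum (fun j => E j i) (fun j => vscale (W i j) (v (tau k i j) j)))
     else x k i) /\
  (forall k i, z k.+1 i =
     if i == act k then vscale (A i i) (zhalf E g x z rho rt tau k i) else z k i) /\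
  (forall k j i, rho (Z.of_nat k + 1)%Z j i =
     if (i == act k) && E i j
     then vadd (rho (Z.of_nat k) j i) (vscale (A j i) (zhalf E g x z rho rt tau k i))
     else rho (Z.of_nat k) j i) /\
  (forall k i j, rt k.+1 i j =
     if (i == act k) && E j i then rho (tau k i j) i j else rt k i j).

Definition xbar {n I : nat} (xk : 'I_I -> vec n) : vec n :=
  vscale (/ INR I) (vsum predT xk).
Definition merit {n I : nat} (g : 'I_I -> vec n -> vec n) (xk : 'I_I -> vec n) : R :=
  Rmax (sqnorm (vsum predT (fun i => g i (xbar xk))))
       (\big[Rplus/0]_(i < I) sqnorm (vsub (xk i) (xbar xk))).

Definition first_hit (M : nat -> R) (delta : R) (k : nat) : Prop :=
  M k <= delta /\ forall j : nat, (j < k)%nat -> delta < M j.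

(* Main.v *)
(** For a time [k] at which agent [i] is active, both halves of the algorithm are
    averaging recursions over earlier (resp. later) activation times with bounded delay:
    the vector [v_i^{k+1}] sent at time [k] is a convex combination (weights [W]) of
    vectors sent earlier, minus the gradient step; and a unit of the mass [z_i^{k+1/2}]
    is split (weights [A]) among masses at later activation times.  A sequence that
    satisfies such an averaging recursion contracts geometrically, because along a path
    of the graph every hop keeps at least a fraction [mbar].  Hence the fundamental
    solution [G] of the first recursion, and that of the second one read backwards in
    time, are asymptotically independent of the observation time, uniformly bounded
    below.

    Fixing a horizon [N], the virtual iterate [c(s) = sum_{t<s} G(N,t) e_t], with [e_t] the
    innovation at time [t], moves by [c(s+1) = c(s) - gam G(N,s) z^s], while [z^s] is a
    uniformly positive multiple of the gradient of [F] at [c(s)] up to errors whose squares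
    are geometrically discounted sums of the [gam^2 |z^t|^2].  Summing the descent
    inequality and closing the loop for small [gam] bounds the sum of the merit function
    over all times, which gives the O(1/delta) hitting time. *)
Require Import Defs.
From HB Require Import structures.
From mathcomp Require Import all_boot zify.
From Stdlib Require Import Relations Reals ZArith Lra Lia Psatz FunctionalExtensionality.
Set Implicit Arguments.
Unset Strict Implicit.
Unset Printing Implicit Defensive.
Open Scope R_scope.

(** * Finite sums and vectors *)

Lemma RplusA : associative Rplus. Proof. by move=> x y z; ring. Qed.
Lemma RplusC : commutative Rplus. Proof. by move=> x y; ring. Qed.
Lemma Rplus0l : left_id 0 Rplus. Proof. by move=> x; ring. Qed.
HB.instance Definition _ := Monoid.isComLaw.Build R 0 Rplus RplusA RplusC Rplus0l.
Lemma Rmul0l : left_zero 0 Rmult. Proof. by move=> x; ring. Qed.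
Lemma Rmul0r : right_zero 0 Rmult. Proof. by move=> x; ring. Qed.
HB.instance Definition _ := Monoid.isMulLaw.Build R 0 Rmult Rmul0l Rmul0r.
Lemma RmulDl : left_distributive Rmult Rplus. Proof. by move=> x y z; ring. Qed.
Lemma RmulDr : right_distributive Rmult Rplus. Proof. by move=> x y z; ring. Qed.
HB.instance Definition _ := Monoid.isAddLaw.Build R Rmult Rplus RmulDl RmulDr.

Section RealSums.
Variable T : Type.
Implicit Types (r : seq T) (P : pred T) (F G : T -> R).

Lemma sumr_ge0 r P F : (forall i, P i -> 0 <= F i) -> 0 <= \big[Rplus/0]_(i <- r | P i) F i.
Proof. by move=> h; elim/big_ind: _ => //; [lra | move=> x y; lra]. Qed.

Lemma ler_sum r P F G : (forall i, P i -> F i <= G i) ->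
  \big[Rplus/0]_(i <- r | P i) F i <= \big[Rplus/0]_(i <- r | P i) G i.
Proof. by move=> h; elim/big_ind2: _ => //; [lra | move=> *; lra]. Qed.

Lemma mulr_suml r P F c :
  c * \big[Rplus/0]_(i <- r | P i) F i = \big[Rplus/0]_(i <- r | P i) (c * F i).
Proof. exact: big_distrr. Qed.

Lemma sumrB r P F G :
  \big[Rplus/0]_(i <- r | P i) (F i - G i) =
  \big[Rplus/0]_(i <- r | P i) F i - \big[Rplus/0]_(i <- r | P i) G i.
Proof. by elim/big_rec3: _ => [|i x y z _ ->]; lra. Qed.

(** Cauchy-Schwarz with [lam i * e i] split as a product of square roots of [Rabs (lam i)]. Signed
    weights are allowed because it is applied later to differences of Green functions. *)
Lemma jensen_sqr r (lam e : T -> R) :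
  (\big[Rplus/0]_(i <- r) (lam i * e i)) ^ 2 <=
  \big[Rplus/0]_(i <- r) Rabs (lam i) *
  \big[Rplus/0]_(i <- r) (Rabs (lam i) * e i ^ 2).
Proof.
elim: r => [|i r IH]; first by rewrite !big_nil; lra.
rewrite !big_cons.
set X := \big[_/_]_(j <- r) (_ * _) in IH *.
set S := \big[_/_]_(j <- r) Rabs _ in IH *.
set V := \big[_/_]_(j <- r) (Rabs _ * _) in IH *.
have S0 : 0 <= S by apply: sumr_ge0 => j _; exact: Rabs_pos.
have V0 : 0 <= V by apply: sumr_ge0 => j _; have := Rabs_pos (lam j); nra.
have a0 := Rabs_pos (lam i); set a := Rabs (lam i) in a0 *.
have la : (lam i * e i) ^ 2 = a ^ 2 * e i ^ 2.
  by rewrite /a -(Rsqr_pow2 (Rabs _)) -Rsqr_abs Rsqr_pow2; ring.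
(* Multiplied by [S], this is [(S * |e i| - |X|)^2 >= 0] combined with the induction hypothesis
   [X^2 <= S * V]. If [S = 0], that hypothesis forces [X = 0]. *)
have key : 2 * Rabs X * Rabs (e i) <= S * e i ^ 2 + V.
  have eX : X ^ 2 = Rabs X ^ 2 by rewrite -!Rsqr_pow2 -Rsqr_abs.
  have eE : e i ^ 2 = Rabs (e i) ^ 2 by rewrite -!Rsqr_pow2 -Rsqr_abs.
  rewrite eE; rewrite eX in IH.
  have X0 := Rabs_pos X; have e0 := Rabs_pos (e i).
  move: (Rabs X) (Rabs (e i)) X0 e0 IH => x y x0 y0 IH.
  case: (Req_dec S 0) => [s0|sn]; last first.
    apply: (Rmult_le_reg_l S); first lra.
    have := pow2_ge_0 (S * y - x); nra.
  have -> : x = 0 by rewrite s0 in IH; nra.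
  rewrite s0; nra.
have cross : 2 * (X * (lam i * e i)) <= a * (S * e i ^ 2 + V).
  apply: (Rle_trans _ (a * (2 * Rabs X * Rabs (e i)))); last by apply: Rmult_le_compat_l.
  have := Rle_abs (X * (lam i * e i)); rewrite !Rabs_mult -/a; lra.
have : (lam i * e i + X) ^ 2 = (lam i * e i) ^ 2 + 2 * (X * (lam i * e i)) + X ^ 2 by ring.
rewrite la => ->; nra.
Qed.

End RealSums.

Lemma sum_ordS (F : nat -> R) N :
  \big[Rplus/0]_(t < N.+1) F t = \big[Rplus/0]_(t < N) F t + F N.
Proof. exact: big_ord_recr. Qed.

Lemma sum_ord_widen (F : nat -> R) a k : (a <= k)%nat ->
  \big[Rplus/0]_(t < a) F t = \big[Rplus/0]_(t < k) (if (t < a)%nat then F t else 0).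
Proof. by move=> ak; rewrite (big_ord_widen k F ak) big_mkcond. Qed.

Section Vectors.
Variable n : nat.
Implicit Types u w a : vec n.

Lemma sqnormE u : sqnorm u = \big[Rplus/0]_(l < n) (u l ^ 2).
Proof. by apply: eq_bigr => l _; ring. Qed.

Lemma sqnorm_ge0 u : 0 <= sqnorm u.
Proof. by rewrite sqnormE; apply: sumr_ge0 => l _; exact: pow2_ge_0. Qed.

Lemma eq_sqnorm u w : u =1 w -> sqnorm u = sqnorm w.
Proof. by move=> h; rewrite !sqnormE; apply: eq_bigr => l _; rewrite h. Qed.

Lemma sqnorm_le2 u w a : (forall l, u l = w l + a l) -> sqnorm u <= 2 * sqnorm w + 2 * sqnorm a.
Proof.
move=> h; rewrite !sqnormE !mulr_suml -big_split /=; apply: ler_sum => l _.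
rewrite h; have := pow2_ge_0 (w l - a l); nra.
Qed.

Lemma sqnorm_scale c u : sqnorm (vscale c u) = c ^ 2 * sqnorm u.
Proof. by rewrite !sqnormE mulr_suml; apply: eq_bigr => l _; rewrite /vscale; ring. Qed.

Lemma sqnorm_subC u w : sqnorm (vsub u w) = sqnorm (vsub w u).
Proof. by rewrite !sqnormE; apply: eq_bigr => l _; rewrite /vsub; ring. Qed.

Lemma sqnorm_sub_trans a u w :
  sqnorm (vsub u w) <= 2 * sqnorm (vsub u a) + 2 * sqnorm (vsub w a).
Proof. by rewrite (sqnorm_subC w a); apply: sqnorm_le2 => l; rewrite /vsub; ring. Qed.

Lemma sqnorm_sum_le (T : Type) (r : seq T) (lam : T -> R) (e : T -> vec n) u :
  (forall l, u l = \big[Rplus/0]_(t <- r) (lam t * e t l)) ->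
  sqnorm u <= \big[Rplus/0]_(t <- r) Rabs (lam t) *
              \big[Rplus/0]_(t <- r) (Rabs (lam t) * sqnorm (e t)).
Proof.
move=> h; rewrite sqnormE.
apply: (Rle_trans _ (\big[Rplus/0]_(l < n) (\big[Rplus/0]_(t <- r) Rabs (lam t) *
              \big[Rplus/0]_(t <- r) (Rabs (lam t) * e t l ^ 2)))).
  by apply: ler_sum => l _; rewrite h; exact: jensen_sqr.
rewrite -mulr_suml exchange_big /=; apply: Req_le; congr (_ * _).
by apply: eq_bigr => t _; rewrite -mulr_suml sqnormE.
Qed.

Lemma sqnorm_convex_le (T : finType) (c : T -> R) (y : T -> vec n) u w M :
  (forall j, 0 <= c j) -> \big[Rplus/0]_j c j = 1 ->
  (forall l, u l = \big[Rplus/0]_j (c j * y j l)) ->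
  (forall j, sqnorm (vsub (y j) w) <= M) -> sqnorm (vsub u w) <= M.
Proof.
move=> c0 c1 hu hM.
have h l : vsub u w l = \big[Rplus/0]_j (c j * vsub (y j) w l).
  rewrite /vsub hu; under [RHS]eq_bigr => j _ do rewrite Rmult_minus_distr_l (Rmult_comm _ (w l)).
  by rewrite sumrB -mulr_suml c1; ring.
apply: Rle_trans (sqnorm_sum_le h) _.
rewrite (eq_bigr c) => [|j _]; last by rewrite Rabs_pos_eq.
rewrite c1 Rmult_1_l.
apply: (Rle_trans _ (\big[Rplus/0]_j (M * c j))); last by rewrite -mulr_suml c1; lra.
apply: ler_sum => j _; rewrite Rabs_pos_eq // Rmult_comm.
by apply: Rmult_le_compat_r.
Qed.

Lemma sqnorm_vsum_le (T : finType) (e : T -> vec n) :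
  sqnorm (vsum predT e) <= INR #|T| * \big[Rplus/0]_t sqnorm (e t).
Proof.
have h l : vsum predT e l = \big[Rplus/0]_t (1 * e t l) by apply: eq_bigr => t _; ring.
apply: Rle_trans (sqnorm_sum_le h) _; rewrite Rabs_R1.
have -> : \big[Rplus/0]_(t : T) 1 = INR #|T|.
  by rewrite big_const cardE; elim: (size _) => //= m ->; case: m => [|m] /=; lra.
apply: Req_le; congr (_ * _); apply: eq_bigr => t _; ring.
Qed.

Lemma dot_vscaler u c w : dot u (vscale c w) = c * dot u w.
Proof. by rewrite /dot mulr_suml; apply: eq_bigr => l _; rewrite /vscale; ring. Qed.

Lemma dot_young u w : dot u w <= / 2 * sqnorm u + / 2 * sqnorm w.
Proof.
rewrite /dot !sqnormE !mulr_suml -big_split /=; apply: ler_sum => l _.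
have := pow2_ge_0 (u l - w l); nra.
Qed.

End Vectors.

(** * Averaging recursions with bounded delay *)

(** Walks of exactly [p] edges: the length is recorded because it is later converted into a waiting
    time [p * B]. *)
Fixpoint reach {I : nat} (E : rel 'I_I) (p : nat) (i j : 'I_I) : Prop :=
  if p is q.+1 then exists2 a, reach E q i a & E a j else i = j.

Lemma strongly_connected_reach (I : nat) (E : rel 'I_I) :
  strongly_connected E -> forall i j, exists p, reach E p i j.
Proof.
move=> sc i j; elim: (Operators_Properties.clos_rt_rtn1 _ _ _ _ (sc i j)) => [|a b ab _ [p ip]].
  by exists 0%nat.
by exists p.+1, a.
Qed.

Lemma reach_trans (I : nat) (E : rel 'I_I) p q i a j :
  reach E p i a -> reach E q a j -> reach E (p + q) i j.
Proof.
move=> ia; elim: q j => [|q IH] j /=; first by rewrite addn0 => <-.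
by case=> b /IH ib bj; rewrite addnS; exists b.
Qed.

Lemma reach_converse (I : nat) (E : rel 'I_I) p i j :
  reach E p i j -> reach (fun a b => E b a) p j i.
Proof.
elim: p j => [|p IH] j //= [a /IH ai aj].
by apply: (@reach_trans _ (fun a b => E b a) 1 p j a i) => //; exists j.
Qed.

Lemma fin_uniform_bound (T : finType) (Q : T -> nat -> Prop) :
  (forall x, exists p, Q x p) -> exists P, forall x, exists2 p, (p <= P)%nat & Q x p.
Proof.
move=> h; suff [P hP] : exists P, forall x, x \in enum T -> exists2 p, (p <= P)%nat & Q x p.
  by exists P => x; apply: hP; rewrite mem_enum.
elim: (enum T) => [|x r [P IH]]; first by exists 0%nat.
have [p Qp] := h x; exists (maxn p P) => y; rewrite inE => /orP [/eqP ->|/IH [q qP Qq]].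
  by exists p => //; rewrite leq_maxl.
by exists q => //; apply: leq_trans qP (leq_maxr _ _).
Qed.

Lemma bounded_reach (I : nat) (E : rel 'I_I) : strongly_connected E ->
  exists P, forall i j, exists2 p, (p <= P)%nat & reach E p i j.
Proof.
move=> sc; have h := strongly_connected_reach sc.
have [P hP] := @fin_uniform_bound _ (fun x : 'I_I * 'I_I => fun p => reach E p x.1 x.2)
  (fun x => h x.1 x.2).
by exists P => i j; exact: (hP (i, j)).
Qed.

Lemma bernoulli x k : 0 <= x <= 1 -> 1 - INR k * x <= (1 - x) ^ k.
Proof.
move=> hx; elim: k => [|k IH]; first by rewrite /=; lra.
rewrite S_INR /=; have := pos_INR k; have : 0 <= (1 - x) ^ k by apply: pow_le; lra.
nra.
Qed.

Lemma pow_le1 r k : 0 <= r <= 1 -> 0 <= r ^ k <= 1.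
Proof. by move=> hr; elim: k => [|k IH] /=; [lra | nra]. Qed.

Lemma pow_mono r a b : 0 <= r <= 1 -> (a <= b)%nat -> r ^ b <= r ^ a.
Proof.
move=> hr ab; have -> : b = (a + (b - a))%nat by lia.
rewrite -plusE pow_add; have := pow_le1 (b - a) hr; have := pow_le1 a hr; nra.
Qed.

(* [c k j] is the weight with which the value at time [k] depends on the value
   at the earlier time [sig k j], at which agent [j] is active. *)
Definition averaging_kernel (I : nat) (E : rel 'I_I) (mb : R) (B : nat) (dom : pred nat)
    (act : nat -> 'I_I) (c : nat -> 'I_I -> R) (sig : nat -> 'I_I -> nat) : Prop :=
  forall k, dom k ->
  [/\ forall j, 0 <= c k j,
      \big[Rplus/0]_j c k j = 1,
      forall j, (sig k j < k <= sig k j + B)%nat,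
      forall j, (j == act k) || E j (act k) -> mb <= c k j /\ act (sig k j) = j &
      forall s, (s < k)%nat -> act s = act k -> (s <= sig k (act k))%nat].

(** The recursion jumps from [k] to arbitrary times [sig k j], so it is made structural by fuel. For
    an averaging kernel these times are smaller than [k], hence fuel [k.+1] is enough. *)
Fixpoint green_fuel (I : nat) (dom : pred nat) (c : nat -> 'I_I -> R)
    (sig : nat -> 'I_I -> nat) (fuel k s : nat) : R :=
  if fuel is m.+1 then
    (if k == s then 1 else 0) +
    (if dom k then \big[Rplus/0]_j (c k j * green_fuel dom c sig m (sig k j) s) else 0)
  else 0.

Definition green (I : nat) (dom : pred nat) (c : nat -> 'I_I -> R)
    (sig : nat -> 'I_I -> nat) (k s : nat) : R := green_fuel dom c sig k.+1 k s.

(** * Comparison principle and fundamental solution of an averaging recursion *)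

Section Kernel.
Variables (I : nat) (E : rel 'I_I) (mb : R) (B : nat).
Variables (dom : pred nat) (act : nat -> 'I_I) (c : nat -> 'I_I -> R) (sig : nat -> 'I_I -> nat).
Hypothesis ker : averaging_kernel E mb B dom act c sig.

(** The upper end [h] is there because the backward recursion for the masses holds only on a bounded
    range of times. *)
Definition averages_on (u : nat -> R) (s h : nat) : Prop :=
  forall k, (s < k <= h)%nat -> dom k /\ u k = \big[Rplus/0]_j (c k j * u (sig k j)).

Lemma averages_affine u s h a b :
  averages_on u s h -> averages_on (fun k => a * u k + b) s h.
Proof.
move=> hu k /hu [dk uk]; split=> //; have [_ c1 _ _ _] := ker dk.
rewrite uk; transitivity (a * \big[Rplus/0]_j (c k j * u (sig k j)) +
    b * \big[Rplus/0]_j c k j); first by rewrite c1; ring.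
rewrite !mulr_suml -big_split /=; apply: eq_bigr => j _; ring.
Qed.

(** Convex averages preserve a lower bound, and delays below or equal to [B] make the window of the
    [B] last times up to [s] a complete set of initial data. *)
Lemma averages_ge u s h lb : averages_on u s h ->
  (forall k, (k <= s < k + B)%nat -> lb <= u k) ->
  forall k, (k <= h)%nat -> (s < k + B)%nat -> lb <= u k.
Proof.
move=> hu hs; elim/ltn_ind => k IH kh sk.
case: (leqP k s) => ks; first by apply: hs; lia.
have [dk ->] := hu k ltac:(lia); have [c0 c1 hsig _ _] := ker dk.
rewrite -[lb]Rmult_1_r -c1 mulr_suml; apply: ler_sum => j _.
rewrite Rmult_comm; apply: Rmult_le_compat_l => //.
by have := hsig j => ?; apply: IH; lia.
Qed.

Lemma averages_le u s h ub : averages_on u s h ->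
  (forall k, (k <= s < k + B)%nat -> u k <= ub) ->
  forall k, (k <= h)%nat -> (s < k + B)%nat -> u k <= ub.
Proof.
move=> hu hs k kh sk.
have := @averages_ge _ s h (- ub) (averages_affine (-1) 0 hu) _ k kh sk.
by move=> H; have := H (fun i hi => ltac:(have := hs i hi; lra)); lra.
Qed.

Notation G := (green dom c sig).

Lemma green_fuelE m m' k s : (k < m)%nat -> (k < m')%nat ->
  green_fuel dom c sig m k s = green_fuel dom c sig m' k s.
Proof.
elim: m m' k => // m IH [|m'] k //= hm hm'; congr (_ + _).
case: ifP => // dk; have [_ _ hsig _ _] := ker dk.
by apply: eq_bigr => j _; congr (_ * _); have := hsig j => ?; apply: IH; lia.
Qed.

Lemma greenE k s : G k s = (if k == s then 1 else 0) +
  (if dom k then \big[Rplus/0]_j (c k j * G (sig k j) s) else 0).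
Proof.
rewrite {1}/green /=; congr (_ + _); case: ifP => // dk; have [_ _ hsig _ _] := ker dk.
by apply: eq_bigr => j _; congr (_ * _); have := hsig j => ?; apply: green_fuelE; lia.
Qed.

Lemma green_before k s : (k < s)%nat -> G k s = 0.
Proof.
elim/ltn_ind: k => k IH ks; rewrite greenE (_ : (k == s) = false); last lia.
case: ifP => dk; last lra; have [_ _ hsig _ _] := ker dk.
by rewrite big1 ?Rplus_0_l // => j _; have := hsig j => ?; rewrite IH; [ring | lia | lia].
Qed.

Lemma green_diag s : G s s = 1.
Proof.
rewrite greenE eqxx; case: ifP => ds; last lra; have [_ _ hsig _ _] := ker ds.
by rewrite big1 ?Rplus_0_r // => j _; have := hsig j => ?; rewrite green_before; [ring | lia].
Qed.

Lemma green_bounds k s : 0 <= G k s <= 1.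
Proof.
elim/ltn_ind: k => k IH; case: (ltngtP k s) => ks.
- by rewrite green_before //; lra.
- rewrite greenE (_ : (k == s) = false); last lia.
  case: ifP => dk; last lra; have [c0 c1 hsig _ _] := ker dk.
  have hj j := IH (sig k j) (proj1 (andP (hsig j))).
  rewrite Rplus_0_l; split.
    by apply: sumr_ge0 => j _; have := hj j; have := c0 j; nra.
  by rewrite -c1; apply: ler_sum => j _; have := hj j; have := c0 j; nra.
- by rewrite ks green_diag; lra.
Qed.

Lemma green_averages s0 s h : (s0 <= s)%nat -> (forall k, (s < k <= h)%nat -> dom k) ->
  averages_on (G^~ s0) s h.
Proof.
move=> s0s hd k hk; have dk := hd k hk; split=> //.
by rewrite greenE dk (_ : (k == s0) = false) ?Rplus_0_l //; lia.
Qed.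

(** Variation of constants: by linearity, the solution driven by the innovations [e] superposes the
    responses to unit impulses. *)
Lemma green_superposition (y e : nat -> R) :
  (forall k, y k = e k + (if dom k then \big[Rplus/0]_j (c k j * y (sig k j)) else 0)) ->
  forall N k, (k < N)%nat -> y k = \big[Rplus/0]_(t < N) (G k t * e t).
Proof.
move=> hy N; elim/ltn_ind => k IH kN; rewrite hy.
under [RHS]eq_bigr => t _ do rewrite greenE Rmult_plus_distr_r.
rewrite big_split /=; congr (_ + _).
  rewrite (bigD1 (Ordinal kN)) //= eqxx big1 ?Rplus_0_r; first by ring.
  by move=> t /eqP tk; case: eqP => [e1|_]; [case: tk; apply: val_inj | ring].
case: ifP => dk; last by rewrite big1 // => t _; ring.
have [_ _ hsig _ _] := ker dk.
transitivity (\big[Rplus/0]_j \big[Rplus/0]_(t < N) (c k j * (G (sig k j) t * e t))).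
  by apply: eq_bigr => j _; have := hsig j => ?; rewrite -mulr_suml -IH //; lia.
rewrite exchange_big /=; apply: eq_bigr => t _.
by rewrite Rmult_comm mulr_suml; apply: eq_bigr => j _; ring.
Qed.

End Kernel.

(** * Geometric forgetting of the initial window *)

Section Contraction.
Variables (I : nat) (E : rel 'I_I) (mb : R) (B P : nat).
Hypothesis mb01 : 0 < mb < 1.
Hypothesis B0 : (0 < B)%nat.
Hypothesis EP : forall i j, exists2 p, (p <= P)%nat & reach E p i j.

Let K := (P * B + B)%nat.
Let eta := mb ^ K.

Variables (dom : pred nat) (act : nat -> 'I_I) (c : nat -> 'I_I -> R) (sig : nat -> 'I_I -> nat).
Hypothesis ker : averaging_kernel E mb B dom act c sig.

Notation averages_on := (averages_on dom c sig).
Notation G := (green dom c sig).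

(** The value at [t] is traced back to time [s] along a walk of [p] edges. Each hop keeps a fraction
    [mb] and goes back at least one time unit, so at most [t - s] factors are lost; it goes back at
    most [B] units, so [p * B] units leave room for the whole walk. *)
Lemma averages_growth u s h : averages_on u s h ->
  (forall k, (k <= s < k + B)%nat -> 0 <= u k) ->
  forall p i t, reach E p (act s) i -> act t = i -> (s + p * B <= t <= h)%nat ->
  mb ^ (t - s) * u s <= u t.
Proof.
move=> hu hs.
have u0 := averages_ge ker hu hs.
have step t r j : (s < t <= h)%nat -> (j == act t) || E j (act t) -> r = sig t j -> (s <= r)%nat ->
    mb ^ (r - s) * u s <= u r -> mb ^ (t - s) * u s <= u t.
  move=> hst ej -> sr IH; have [dt ut] := hu t hst; have [c0 _ hsig /(_ _ ej) [cj _] _] := ker dt.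
  have hj := hsig j.
  have us : 0 <= u s by apply: hs; lia.
  have ur : 0 <= u (sig t j) by apply: u0; lia.
  have : mb * u (sig t j) <= u t.
    rewrite ut (bigD1 j) //=; set S := (X in _ <= _ + X).
    suff S0 : 0 <= S by have := Rmult_le_compat_r _ _ _ ur cj; lra.
    apply: sumr_ge0 => i _; apply: Rmult_le_pos => //.
    by have := hsig i => ?; apply: u0; lia.
  have : mb ^ (t - s) <= mb ^ (sig t j - s).+1 by apply: pow_mono; [lra | lia].
  rewrite /=; have : 0 <= mb ^ (sig t j - s) by apply: pow_le; lra.
  nra.
elim=> [|p IH] i t /=; last first.
  case=> j rj ji at_i ht; have [dt _] := hu t ltac:(lia).
  have [_ _ hsig hE _] := ker dt.
  have Ej : (j == act t) || E j (act t) by rewrite at_i ji orbT.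
  have [_ aj] := hE _ Ej; have hj := hsig j.
  apply: (step t _ j _ Ej erefl); [lia | lia |].
  by apply: (IH j) => //; lia.
(* Once the walk has reached the agent active at [s], the descent follows this agent's own earlier
   activations. The last clause of the kernel prevents it from jumping over [s]. *)
elim/ltn_ind: t => t IH is_i at_i ht.
case: (eqVneq t s) => [->|ts]; first by rewrite subnn /=; lra.
have [dt _] := hu t ltac:(lia); have [_ _ hsig hE hself] := ker dt.
have Ej : (act t == act t) || E (act t) (act t) by rewrite eqxx.
have [_ aj] := hE _ Ej; have hj := hsig (act t).
have sr : (s <= sig t (act t))%nat by apply: hself; [lia | rewrite is_i].
apply: (step t _ (act t) _ Ej erefl) => //; first lia.
by apply: IH => //; [lia | rewrite aj | lia].
Qed.

(** Growth along walks covers the times from [s + P * B] to [s + K]. These contain a full window of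
    length [B], from which the comparison principle carries the bound to all later times. *)
Lemma averages_lower_bound u s h : averages_on u s h ->
  (forall k, (k <= s < k + B)%nat -> 0 <= u k) ->
  forall t, (s + P * B <= t <= h)%nat -> eta * u s <= u t.
Proof.
move=> hu hs.
have us : 0 <= u s by apply: hs; lia.
have near t : (s + P * B <= t <= h)%nat -> (t <= s + K)%nat -> eta * u s <= u t.
  move=> ht tK; have [p pP rp] := EP (act s) (act t).
  have pB : (p * B <= P * B)%nat by rewrite leq_mul2r pP orbT.
  apply: (Rle_trans _ (mb ^ (t - s) * u s)).
    by apply: Rmult_le_compat_r => //; apply: pow_mono; [lra | rewrite leq_subLR].
  by apply: (averages_growth hu hs rp) => //; lia.
move=> t ht; case: (leqP t (s + K)) => tK; first exact: near.
apply: (@averages_ge _ _ _ _ _ _ _ _ ker u (s + K) h) => //; try lia.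
  by move=> k hk; apply: hu; lia.
by move=> k hk; apply: near; rewrite /K in hk tK *; lia.
Qed.

(** The lower bound is applied to both [u - lb] and [ub - u]; the two gains add up to
    [eta * (ub - lb)], whatever the value [u s] is. *)
Lemma averages_contract_step u s h lb ub : averages_on u s h -> (s + K <= h)%nat ->
  (forall k, (k <= s < k + B)%nat -> lb <= u k <= ub) ->
  exists lb' ub', ub' - lb' = (1 - eta) * (ub - lb) /\
    forall k, (k <= s + K < k + B)%nat -> lb' <= u k <= ub'.
Proof.
move=> hu hK hs.
have us : lb <= u s <= ub by apply: hs; lia.
exists (lb + eta * (u s - lb)), (ub - eta * (ub - u s)); split; first by ring.
move=> k hk.
have h1 := @averages_lower_bound _ s h (averages_affine ker 1 (- lb) hu) _ k _.
have h2 := @averages_lower_bound _ s h (averages_affine ker (-1) ub hu) _ k _.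
have {}h1 := h1 (fun i hi => ltac:(have := hs i hi; lra)) ltac:(rewrite /K in hk hK; lia).
have {}h2 := h2 (fun i hi => ltac:(have := hs i hi; lra)) ltac:(rewrite /K in hk hK; lia).
lra.
Qed.

Lemma averages_contract u s h lb ub q : averages_on u s h -> (s + q * K <= h)%nat ->
  (forall k, (k <= s < k + B)%nat -> lb <= u k <= ub) ->
  exists lb' ub', ub' - lb' = (1 - eta) ^ q * (ub - lb) /\
    forall k, (k <= s + q * K < k + B)%nat -> lb' <= u k <= ub'.
Proof.
elim: q s lb ub => [|q IH] s lb ub hu hq hs.
  by exists lb, ub; split; [rewrite /=; ring | move=> k; rewrite mul0n addn0; exact: hs].
have K1 : (s + K <= h)%nat by lia.
have [lb1 [ub1 [e1 h1]]] := averages_contract_step hu K1 hs.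
have [||lb2 [ub2 [e2 h2]]] := IH (s + K)%nat lb1 ub1 _ _ h1.
- by move=> k hk; apply: hu; lia.
- lia.
exists lb2, ub2; split; first by rewrite e2 e1 /=; ring.
by move=> k hk; apply: h2; lia.
Qed.

(** A rate per time unit: by Bernoulli, [1 - eta <= rho ^ K], so it is no faster than the
    contraction per block of length [K]. *)
Let rho := 1 - eta / INR K.

Lemma eta_bounds : 0 < eta < 1.
Proof.
have K0 : (0 < K)%nat by rewrite /K; lia.
split; first by apply: pow_lt; lra.
rewrite /eta; case: {K0}K (K0) => // m _ /=; have := @pow_le1 mb m ltac:(lra); nra.
Qed.

Lemma rho_bounds : 0 < rho < 1.
Proof.
have K1 : 1 <= INR K by apply: (le_INR 1); rewrite /K; lia.
have he := eta_bounds.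
have e : eta / INR K * INR K = eta by field; lra.
rewrite /rho; split; nra.
Qed.

(** The factor [rho ^ K] on the left pays for the incomplete block that is lost when [r - s] is
    divided by [K]. *)
Lemma averages_decay u s h lb ub r k k' : averages_on u s h ->
  (forall k, (k <= s < k + B)%nat -> lb <= u k <= ub) ->
  (s <= r <= h)%nat -> (r < k + B)%nat -> (r < k' + B)%nat -> (k <= h)%nat -> (k' <= h)%nat ->
  rho ^ K * Rabs (u k - u k') <= rho ^ (r - s) * (ub - lb).
Proof.
move=> hu hs hr hk hk' kh k'h.
have K0 : (0 < K)%nat by rewrite /K; lia.
have he := eta_bounds; have hrho := rho_bounds.
have us := hs s ltac:(lia).
set q := ((r - s) %/ K)%nat.
have eq := divn_eq (r - s) K; have lt := ltn_pmod (r - s) K0; rewrite -/q in eq.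
have [lb' [ub' [e h1]]] := averages_contract (q := q) hu ltac:(lia) hs.
have hu' : averages_on u (s + q * K) h by move=> i hi; apply: hu; lia.
have lo' := averages_ge ker hu' (fun i hi => proj1 (h1 i hi)).
have up' := averages_le ker hu' (fun i hi => proj2 (h1 i hi)).
have d : Rabs (u k - u k') <= (1 - eta) ^ q * (ub - lb).
  rewrite -e; apply: Rabs_le.
  have := lo' k kh ltac:(lia); have := lo' k' k'h ltac:(lia).
  have := up' k kh ltac:(lia); have := up' k' k'h ltac:(lia); lra.
have bern : (1 - eta) ^ q <= rho ^ (q * K).
  rewrite mulnC -multE pow_mult; apply: pow_incr; split; first lra.
  have K1 : 1 <= INR K by apply: (le_INR 1); lia.
  have := @bernoulli (eta / INR K) K.
  have -> : INR K * (eta / INR K) = eta by field; lra.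
  by apply; rewrite /rho in hrho; lra.
apply: (Rle_trans _ (rho ^ K * (rho ^ (q * K) * (ub - lb)))).
  apply: Rmult_le_compat_l; first by apply: pow_le; lra.
  apply: Rle_trans d _; apply: Rmult_le_compat_r => //; lra.
rewrite -Rmult_assoc -pow_add plusE; apply: Rmult_le_compat_r; first lra.
by apply: pow_mono; [lra | lia].
Qed.

Lemma green_lower_bound s h t : (forall k, (s < k <= h)%nat -> dom k) ->
  (s + P * B <= t <= h)%nat -> eta <= G t s.
Proof.
move=> hd ht; have := averages_lower_bound (green_averages ker (leqnn s) hd) _ ht.
by rewrite (green_diag ker) Rmult_1_r; apply=> k _; case: (green_bounds ker k s).
Qed.

(** As a function of the observation time, the Green function solves the averaging recursion after
    its source [s0], with values between 0 and 1; hence two late observations almost agree. *)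
Lemma green_decay s0 s h r k k' : (s0 <= s)%nat -> (forall k, (s < k <= h)%nat -> dom k) ->
  (s <= r <= h)%nat -> (r < k + B)%nat -> (r < k' + B)%nat -> (k <= h)%nat -> (k' <= h)%nat ->
  rho ^ K * Rabs (G k s0 - G k' s0) <= rho ^ (r - s).
Proof.
move=> s0s hd hr hk hk' kh k'h.
have := @averages_decay (G^~ s0) s h 0 1 r k k' (green_averages ker s0s hd) _ hr hk hk' kh k'h.
by rewrite Rminus_0_r Rmult_1_r; apply=> i _; exact: green_bounds ker _ _.
Qed.

End Contraction.

(** * ASY-SONATA as two averaging recursions *)

Fixpoint acted {I : nat} (act : nat -> 'I_I) (s : nat) (i : 'I_I) : bool :=
  if s is r.+1 then (act r == i) || acted act r i else false.

(* The last activation of [i] strictly before [s]; junk value [0] if there is none. *)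
Fixpoint last_act {I : nat} (act : nat -> 'I_I) (s : nat) (i : 'I_I) : nat :=
  if s is r.+1 then (if act r == i then r else last_act act r i) else 0%nat.

(** * Last activation times *)

Section Activation.
Variables (I : nat) (act : nat -> 'I_I).

Lemma actedP s i : reflect (exists2 t, (t < s)%nat & act t = i) (acted act s i).
Proof.
elim: s => [|s IH] /=; first by constructor; case.
apply: (iffP orP) => [[/eqP <-|/IH [t ts <-]]|[t ts ti]].
- by exists s.
- by exists t => //; lia.
- case: (eqVneq t s) => [e|ts']; first by left; rewrite -e ti.
  by right; apply/IH; exists t => //; lia.
Qed.

Lemma last_act_spec s i : acted act s i ->
  act (last_act act s i) = i /\ (last_act act s i < s)%nat.
Proof.
elim: s => // s IH /=; case: eqP => [->|_ /= /IH [-> h]]; first by split.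
by split=> //; lia.
Qed.

Lemma last_act_max s i t : (t < s)%nat -> act t = i -> (t <= last_act act s i)%nat.
Proof.
elim: s => // s IH /= ts ti; case: eqP => [_|h]; first by lia.
by apply: IH => //; case: (eqVneq t s) => [e|]; [rewrite -e in h | lia].
Qed.

End Activation.

Section Model.
Variables (n I : nat) (E : rel 'I_I) (W A : 'I_I -> 'I_I -> R) (mbar : R) (T D : nat).
Variables (g : 'I_I -> vec n -> vec n) (gam : R) (act : nat -> 'I_I) (d : nat -> 'I_I -> nat).
Variables (x z : nat -> 'I_I -> vec n) (v : Z -> 'I_I -> vec n)
  (rho : Z -> 'I_I -> 'I_I -> vec n) (rt : nat -> 'I_I -> 'I_I -> vec n)
  (tau : nat -> 'I_I -> 'I_I -> Z).
Hypothesis nsl : no_self_loops E.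
Hypotheses (Wrow : row_stochastic W) (Wpat : weight_pattern E mbar W).
Hypotheses (Acol : col_stochastic A) (Apat : weight_pattern E mbar A).
Hypothesis async : asynchrony_model E T D act d.
Hypothesis alg : asy_sonata E W A D g gam act d x z v rho rt tau.

Notation last := (last_act act).

Lemma acted_window s i : (T <= s)%nat -> acted act s i.
Proof.
move=> Ts; have [/(_ (s - T)%nat i) [t [ht ti]] _] := async.
by apply/actedP; exists t => //; lia.
Qed.

Lemma T_gt0 : (0 < T)%nat.
Proof. have [/(_ 0%nat (act 0)) [t [ht _]] _] := async; lia. Qed.

Lemma last_window s i : (T <= s)%nat ->
  act (last s i) = i /\ (last s i < s <= last s i + T)%nat.
Proof.
move=> Ts; have [h1 h2] := last_act_spec (acted_window i Ts); split=> //.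
have [/(_ (s - T)%nat i) [t [ht ti]] _] := async.
by have := @last_act_max _ act s i t ltac:(lia) ti; lia.
Qed.

(** Both sequences are indexed by time only: [sent k] is the vector [v] and [mass k] the half-step
    [z] that the agent active at [k] computes. *)
Definition sent (k : nat) : vec n := v (Z.of_nat k + 1)%Z (act k).
Definition mass (k : nat) : vec n := zhalf E g x z rho rt tau k (act k).

Lemma ZsuccE k : Z.of_nat k.+1 = (Z.of_nat k + 1)%Z. Proof. lia. Qed.

Lemma v_last s i : acted act s i -> v (Z.of_nat s) i = sent (last s i).
Proof.
case: alg => _ [_] [_] [_] [_] [hv _].
elim: s => // s IH; rewrite ZsuccE /=.
case: eqP => [<- _|h /= /IH {}IH] //.
by rewrite hv eq_sym; case: eqP => // _; rewrite IH.
Qed.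

Lemma x_last s i : acted act s i -> x s i = x (last s i).+1 i.
Proof.
case: alg => _ [_] [_] [_] [_] [_] [hx _].
elim: s => // s IH /=; case: eqP => [_|h /= /IH {}IH] //.
by rewrite hx eq_sym; case: eqP.
Qed.

Lemma z_last s i : acted act s i -> z s i = vscale (A i i) (mass (last s i)).
Proof.
case: alg => _ [_] [_] [_] [_] [_] [_] [hz _].
elim: s => // s IH /=; rewrite hz eq_sym; case: eqP => [e _|h /= /IH {}IH] //.
by rewrite /mass e.
Qed.

Lemma x_init s i : ~~ acted act s i -> x s i = x 0 i.
Proof.
case: alg => _ [_] [_] [_] [_] [_] [hx _].
by elim: s => // s IH /=; rewrite negb_or hx eq_sym => /andP [/negbTE ->].
Qed.

Lemma z_init s i : ~~ acted act s i -> z s i = g i (x 0 i).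
Proof.
case: alg => h0 [_] [_] [_] [_] [_] [_] [hz _].
by elim: s => // s IH /=; rewrite negb_or hz eq_sym => /andP [/negbTE ->].
Qed.

(** All that is needed of the time stamps: they are monotone, at most [D] old at an activation of
    [i], frozen at other steps, and within the range where [rho] and [v] are specified. *)
Lemma tau_step k i j : E j i ->
  (tau_prev D tau k i j <= tau k i j)%Z /\
  (act k = i -> (Z.of_nat k - Z.of_nat D <= tau k i j)%Z) /\
  (act k <> i -> tau k i j = tau_prev D tau k i j) /\
  (- Z.of_nat D <= tau_prev D tau k i j <= Z.of_nat k)%Z /\ (tau k i j <= Z.of_nat k)%Z.
Proof.
case: alg => _ [_] [_] [_] [ht _] Eji.
have dk m : act m = i -> (d m j <= D)%nat by move=> e; apply: (proj2 async); rewrite e.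
have upd m : tau m i j = if i == act m
    then Z.max (tau_prev D tau m i j) (Z.of_nat m - Z.of_nat (d m j))
    else tau_prev D tau m i j by exact: ht.
have bnd : (- Z.of_nat D <= tau_prev D tau k i j <= Z.of_nat k)%Z.
  elim: k => [|k IH]; first by rewrite /=; lia.
  rewrite [tau_prev _ _ _ _ _]/= upd; case: eqP => [/esym /dk|_]; lia.
rewrite upd eq_sym; case: eqP => [e|ne].
  have := dk _ e; repeat split => //; lia.
repeat split => //; lia.
Qed.

Lemma tau_lt_mono k k' i j : E j i -> (k < k')%nat -> (tau k i j <= tau_prev D tau k' i j)%Z.
Proof.
move=> Eji; elim: k' => // k' IH kk' /=.
case: (eqVneq k k') => [->|ne]; first lia.
by have := tau_step k' Eji; have := IH ltac:(lia); lia.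
Qed.

(** When [x s i] was last computed, at time [p], the vector used from an in-neighbour [j] had been
    sent at this time. The agent's own vector was produced at [p] itself, and for other agents, of
    weight 0, [p] is a harmless default that keeps the delay bounds valid. *)
Definition source_time (s : nat) (i j : 'I_I) : nat :=
  let p := last s i in
  if E j i then last (Z.to_nat (tau p i j)) j else p.

(** At most [T] back to the last activation of the receiver, [D] for the transmission, and [T] back
    to the last activation of the sender. *)
Let B := (T + T + D)%nat.

Lemma source_time_bounds s i j : (B <= s)%nat ->
  (source_time s i j < s <= source_time s i j + B)%nat.
Proof.
move=> hs; have hT := T_gt0; have [p1 p2] := @last_window s i ltac:(lia).
rewrite /source_time; case: ifP => Eji; last lia.
have [_ [t1 [_ [_ t3]]]] := tau_step (last s i) Eji.
have t2 := t1 p1.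
have := @last_window (Z.to_nat (tau (last s i) i j)) j ltac:(lia); lia.
Qed.

Lemma act_source_time s i j : (B <= s)%nat -> (j == i) || E j i -> act (source_time s i j) = j.
Proof.
move=> hs; have hT := T_gt0; have [p1 p2] := @last_window s i ltac:(lia).
rewrite /source_time; case: ifP => [Eji _|_]; last by rewrite orbF => /eqP ->.
have [_ [t1 [_ [_ t3]]]] := tau_step (last s i) Eji.
have t2 := t1 p1.
by have [] := @last_window (Z.to_nat (tau (last s i) i j)) j ltac:(lia).
Qed.

(** Valid for every agent and not only the active one, because [x s i] has not changed since the
    last activation of [i]. *)
Lemma x_average s i l : (B <= s)%nat ->
  x s i l = \big[Rplus/0]_j (W i j * sent (source_time s i j) l).
Proof.
move=> hs; have hT := T_gt0; have [p1 p2] := @last_window s i ltac:(lia).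
rewrite x_last; last by apply: acted_window; lia.
case: (alg) => _ [_] [_] [_] [_] [_] [hx _]; rewrite hx p1 eqxx.
rewrite (bigD1 i) //= {1}/source_time (negbTE (nsl i)) /vadd /vscale /vsum.
congr (_ + _); first by rewrite /sent p1.
rewrite big_mkcond [RHS]big_mkcond /=; apply: eq_bigr => j _.
case: (boolP (E j i)) => Eji; last first.
  by case: ifP => // ji; case: Wpat => _ [_ ->]; rewrite // ?Rmult_0_l // eq_sym.
have -> : (j != i) by apply: contraTneq Eji => ->; exact: nsl.
rewrite /source_time Eji.
have [_ [t1 [_ [_ t3]]]] := tau_step (last s i) Eji; have t2 := t1 p1.
by rewrite -v_last ?Z2Nat.id //; [lia | apply: acted_window; lia].
Qed.

Lemma sentE k l : sent k l = x k (act k) l - gam * z k (act k) l.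
Proof. by case: (alg) => _ [_] [_] [_] [_] [hv _]; rewrite /sent hv eqxx. Qed.

Lemma consensus_kernel : averaging_kernel E mbar B (fun k => (B <= k)%nat) act
  (fun k j => W (act k) j) (fun k j => source_time k (act k) j).
Proof.
move=> k hk; case: (Wrow) => W0 W1; split => //.
- by move=> j; exact: source_time_bounds.
- move=> j hj; split; last exact: act_source_time.
  case: (Wpat) => h1 [h2 _]; case/orP: hj => [/eqP ->|]; [exact: h1 | exact: h2].
- by move=> s sk e; rewrite /source_time (negbTE (nsl _)); exact: last_act_max.
Qed.

(** * Transport of the gradient masses *)

Lemma rho_sum t i j l : (- Z.of_nat D <= t)%Z ->
  rho t i j l = \big[Rplus/0]_(s < Z.to_nat t)
    (if (act s == j) && E j i then A i j * mass s l else 0).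
Proof.
case: (alg) => _ [_] [h0] [_] [_] [_] [_] [_] [hr _] ht.
case: (Z_le_gt_dec t 0) => t0.
  rewrite h0; last lia.
  by rewrite (_ : Z.to_nat t = 0%nat) ?big_ord0 //; lia.
have -> : t = Z.of_nat (Z.to_nat t) by lia.
rewrite Nat2Z.id; elim: (Z.to_nat t) => {t0 ht t}[|s IH].
  by rewrite h0 ?big_ord0 //; lia.
rewrite ZsuccE hr big_ord_recr /= -IH eq_sym; case: ifP => [/andP [/eqP e _]|_]; last by ring.
by rewrite /vadd /vscale /mass e.
Qed.

(** The buffer stores what was read under the previous time stamp. Hence [rho - rt] in the half-step
    counts exactly the masses emitted between two successive stamps, each of them once. *)
Lemma rt_prev k i j : E j i -> rt k i j = rho (tau_prev D tau k i j) i j.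
Proof.
move=> Eji; case: (alg) => _ [r0] [h0] [_] [ht] [_] [_] [_] [_] hrt.
elim: k => [|k IH]; first by rewrite r0 h0 //=; lia.
rewrite hrt Eji andbT /=; case: eqP => // ne.
by rewrite IH ht //; case: eqP.
Qed.

(* [consumed t j k]: the share of [mass t] routed to agent [j] has re-entered a
   [mass] by the end of step [k].  Non-neighbours (weight [0]) are treated like
   the share the active agent keeps. *)
Definition consumed (t : nat) (j : 'I_I) (k : nat) : bool :=
  if E (act t) j then (t < Z.to_nat (tau k j (act t)))%nat
  else (t < k)%nat && (act k == act t).

Lemma consumed_bounded t j : exists2 k, (k <= t + B)%nat & consumed t j k.
Proof.
rewrite /consumed; case Ej: (E (act t) j).
  have [/(_ (t + D).+1 j) [k [hk ak]] _] := async; exists k; first lia.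
  by have [_ [/(_ ak) h _]] := tau_step k Ej; lia.
have [/(_ t.+1 (act t)) [k [hk ak]] _] := async; exists k; first lia.
by rewrite ak eqxx andbT; lia.
Qed.

Lemma consumed_eventually t j : exists k, consumed t j k.
Proof. by have [k _ h] := consumed_bounded t j; exists k. Qed.

Definition dest (t : nat) (j : 'I_I) : nat := ex_minn (consumed_eventually t j).

Lemma dest_consumed t j : consumed t j (dest t j).
Proof. by rewrite /dest; case: ex_minnP. Qed.

Lemma dest_min t j k : consumed t j k -> (dest t j <= k)%nat.
Proof. by rewrite /dest; case: ex_minnP => m _ h /h. Qed.

Lemma consumed_after t j k : consumed t j k -> (t < k)%nat.
Proof.
rewrite /consumed; case: ifP => [Ej|_ /andP [] //].
by have := tau_step k Ej; lia.
Qed.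

Lemma dest_bounds t j : (t < dest t j <= t + B)%nat.
Proof.
rewrite (consumed_after (dest_consumed t j)) /=.
by have [k kB /dest_min] := consumed_bounded t j; lia.
Qed.

(** Monotone time stamps cut the emission times into disjoint intervals, and step [k] absorbs the
    interval between its previous and its current stamp. *)
Lemma dest_edge t j k : E (act t) j -> (dest t j == k) =
  (Z.to_nat (tau_prev D tau k j (act t)) <= t < Z.to_nat (tau k j (act t)))%nat.
Proof.
move=> Ej; apply/eqP/idP => [<-|/andP [h1 h2]].
  have := dest_consumed t j; rewrite {1}/consumed Ej => ->; rewrite andbT.
  case e: (dest t j) => [|m] /=; first lia.
  rewrite leqNgt; apply/negP => h.
  have : consumed t j m by rewrite /consumed Ej.
  by move/dest_min; rewrite e ltnn.
have c : consumed t j k by rewrite /consumed Ej.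
have le := dest_min c; case: (eqVneq (dest t j) k) => // ne.
have := @tau_lt_mono (dest t j) k j (act t) Ej ltac:(lia).
by have := dest_consumed t j; rewrite {1}/consumed Ej; lia.
Qed.

(** The stamps of [j] move only when [j] is active, so the interval absorbed at any other step is
    empty. *)
Lemma act_dest t j : (j == act t) || E (act t) j -> act (dest t j) = j.
Proof.
case: (boolP (E (act t) j)) => [Ej _|nE].
  have := eqxx (dest t j); rewrite {1}dest_edge // => h.
  case: (eqVneq (act (dest t j)) j) => // /eqP /(proj1 (proj2 (proj2 (tau_step (dest t j) Ej)))).
  lia.
rewrite orbF => /eqP ej; have := dest_consumed t j.
by rewrite {1}/consumed (negbTE nE) ej => /andP [_ /eqP].
Qed.

Lemma dest_self t k : (t < k)%nat -> act k = act t ->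
  (dest t (act t) == k) = (t == last k (act t)).
Proof.
move=> tk e; have ns := negbTE (nsl (act t)).
have c : consumed t (act t) k by rewrite /consumed ns tk e eqxx.
have dm := dest_min c; have /= := dest_consumed t (act t).
rewrite {1}/consumed ns => /andP [h1 /eqP h2].
have ak : acted act k (act t) by apply/actedP; exists t.
have [l1 l2] := last_act_spec ak.
have l3 := last_act_max tk (erefl (act t)).
apply/eqP/eqP => [dk|tl].
  case: (eqVneq t (last k (act t))) => // ne.
  have : consumed t (act t) (last k (act t)) by rewrite /consumed ns l1 eqxx andbT; lia.
  by move/dest_min; lia.
case: (eqVneq (dest t (act t)) k) => // ne.
have := @last_act_max _ act k (act t) (dest t (act t)) ltac:(lia) h2; lia.
Qed.

Definition flow (t k : nat) : R := \big[Rplus/0]_j (if dest t j == k then A j (act t) else 0).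

Lemma flow0 t k : (k <= t)%nat -> flow t k = 0.
Proof.
move=> kt; rewrite /flow big1 // => j _; case: eqP => // e.
by have := dest_bounds t j; lia.
Qed.

(** Only the share routed to [act k] can arrive at step [k]. It is either kept by the agent since
    its last activation or received over an edge, and the absence of self-loops makes the two cases
    exclusive. *)
Lemma flowE t k : (t < k)%nat -> let i := act k in
  flow t k = (if (act t == i) && (t == last k i) then A i i else 0) +
    (if E (act t) i && (Z.to_nat (tau_prev D tau k i (act t)) <= t <
        Z.to_nat (tau k i (act t)))%nat then A i (act t) else 0).
Proof.
move=> tk /=; have [_ [_ A0]] := Apat.
rewrite /flow (bigD1 (act k)) //= big1 ?Rplus_0_r => [|j jk]; last first.
  case: eqP => // ed; case: (boolP ((j == act t) || E (act t) j)) => [/act_dest h|].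
    by rewrite -h ed eqxx in jk.
  by rewrite negb_or => /andP [jt nE]; exact: A0.
case: (boolP (E (act t) (act k))) => Ek.
  rewrite dest_edge //; have -> : (act t == act k) = false.
    by apply/negbTE; apply: contraTneq Ek => ->; exact: nsl.
  by rewrite /= Rplus_0_l.
case: (eqVneq (act t) (act k)) => [e|ne] /=.
  by have := dest_self tk (esym e); rewrite e => ->; rewrite Rplus_0_r.
by rewrite A0 ?(eq_sym (act k)) //; case: ifP => _; ring.
Qed.

Lemma sum_inflow k l : let i := act k in
  \big[Rplus/0]_(t < k) (flow t k * mass t l) =
  (if acted act k i then A i i * mass (last k i) l else 0) +
  \big[Rplus/0]_(j | E j i) (rho (tau k i j) i j l - rt k i j l).
Proof.
move=> i; under [LHS]eq_bigr => t _ do rewrite flowE // Rmult_plus_distr_r.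
rewrite big_split /=; congr (_ + _).
  case: ifP => ak; last first.
    rewrite big1 // => t _; case: eqP => [e|_]; last by rewrite /=; ring.
    by move/negP: ak; case; apply/actedP; exists t.
  have [l1 l2] := last_act_spec ak.
  rewrite (bigD1 (Ordinal l2)) //= l1 !eqxx /= big1 ?Rplus_0_r // => t /eqP tl.
  by case: ifP => [/andP [_ /eqP e]|_]; [case: tl; apply: val_inj | ring].
transitivity (\big[Rplus/0]_(j | E j i) \big[Rplus/0]_(t < k)
    (if (act t == j) && (Z.to_nat (tau_prev D tau k i j) <= t < Z.to_nat (tau k i j))%nat
     then A i j * mass t l else 0)).
  rewrite exchange_big /=; apply: eq_bigr => t _.
  case: (boolP (E (act t) i)) => Et; last first.
    rewrite big1 /= ?Rmult_0_l // => j Ej; case: eqP => //= e; by rewrite e Ej in Et.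
  rewrite (bigD1 (act t)) //= eqxx /= big1 ?Rplus_0_r => [|j /andP [_ /negbTE jt]].
    by rewrite -/i; case: ifP => _; ring.
  by rewrite eq_sym jt.
apply: eq_bigr => j Ej; rewrite rt_prev //.
have [t1 [_ [_ [t2 t3]]]] := tau_step k Ej.
rewrite !rho_sum; [|lia|lia].
rewrite (@sum_ord_widen (fun s => if (act s == j) && E j i then A i j * mass s l else 0) _ k); last lia.
rewrite (@sum_ord_widen (fun s => if (act s == j) && E j i then A i j * mass s l else 0)
  (Z.to_nat (tau_prev D tau k i j)) k); last lia.
rewrite -sumrB; apply: eq_bigr => t _; rewrite Ej andbT.
have t4 : (Z.to_nat (tau_prev D tau k i j) <= Z.to_nat (tau k i j))%nat by lia.
case: (act t == j) => /=; last by case: ifP => _; case: ifP => _; ring.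
rewrite leqNgt; case: (ltnP t (Z.to_nat (tau_prev D tau k i j))) => h1 /=.
  by rewrite (leq_trans h1 t4); ring.
by case: ifP => _; ring.
Qed.

(** Introduced as the defect of mass conservation, so that the duality argument below is pure
    bookkeeping; its value in terms of gradients follows. *)
Definition injected (k : nat) : vec n :=
  fun l => mass k l - \big[Rplus/0]_(t < k) (flow t k * mass t l).

(** The kept share and the newly read buffers account for everything in the half-step except the
    gradient increment. At a first activation nothing was kept, and the initial [z], a gradient,
    counts as injected. *)
Lemma injectedE k l : let i := act k in
  injected k l = g i (x k.+1 i) l - g i (x k i) l + (if acted act k i then 0 else g i (x 0 i) l).
Proof.
move=> i; rewrite /injected sum_inflow -/i {1}/mass -/i /zhalf /vadd /vsum /vsub.
case: ifP => ak; last by rewrite z_init ?ak //; ring.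
by rewrite z_last //= /vscale; ring.
Qed.

(** The gradient-tracking invariant: the increments of each agent that has acted telescope to its
    current gradient. *)
Lemma sum_injected k l : \big[Rplus/0]_(t < k) injected t l =
  \big[Rplus/0]_i (if acted act k i then g i (x k i) l else 0).
Proof.
elim: k => [|k IH]; first by rewrite big_ord0 big1.
rewrite big_ord_recr /= IH injectedE (bigD1 (act k)) //= [RHS](bigD1 (act k)) //= eqxx /=.
have -> : \big[Rplus/0]_(i | i != act k) (if (act k == i) || acted act k i then g i (x k.+1 i) l else 0) =
          \big[Rplus/0]_(i | i != act k) (if acted act k i then g i (x k i) l else 0).
  apply: eq_bigr => i /negbTE ik; rewrite eq_sym ik /=.
  by case: (alg) => _ [_] [_] [_] [_] [_] [hx _]; rewrite hx ik.
set S := \big[Rplus/0]_(i | _) _.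
case: ifP => ak; first by ring.
by rewrite (x_init (negbT ak)); ring.
Qed.

(** [H t] is the fraction of a unit of mass at time [t] that ends up in [mass N]. It solves the
    adjoint recursion, and summation by parts moves the flow from the masses to [H], where it
    cancels at every time but [N]. *)
Lemma mass_duality (H : nat -> R) N : H N = 1 -> (forall t, (N < t)%nat -> H t = 0) ->
  (forall t, (t < N)%nat -> H t = \big[Rplus/0]_j (A j (act t) * H (dest t j))) ->
  forall l, mass N l = \big[Rplus/0]_(t < N.+1) (H t * injected t l).
Proof.
move=> HN H0 Hav l.
have wid t : (t < N.+1)%nat ->
    injected t l = mass t l - \big[Rplus/0]_(r < N.+1) (flow r t * mass r l).
  move=> tN; rewrite /injected (@sum_ord_widen (fun r => flow r t * mass r l) t N.+1) //; last lia.
  congr (_ - _); apply: eq_bigr => r _; case: ltnP => // tr.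
  by rewrite flow0 //; ring.
under eq_bigr => t _ do rewrite wid // Rmult_minus_distr_l mulr_suml.
rewrite sumrB exchange_big /= -sumrB.
have out r : (r < N.+1)%nat ->
    \big[Rplus/0]_(t < N.+1) (H t * (flow r t * mass r l)) =
    mass r l * \big[Rplus/0]_j (A j (act r) * H (dest r j)).
  move=> rN; rewrite mulr_suml.
  transitivity (\big[Rplus/0]_j \big[Rplus/0]_(t < N.+1)
     (if dest r j == t then mass r l * (A j (act r) * H t) else 0)).
    rewrite exchange_big /=; apply: eq_bigr => t _; rewrite /flow.
    rewrite (Rmult_comm _ (mass r l)) -Rmult_assoc mulr_suml; apply: eq_bigr => j _.
    by case: ifP => _; ring.
  apply: eq_bigr => j _; case: (ltnP N (dest r j)) => dN.
    rewrite H0 // big1 => [|t _]; first by ring.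
    by case: eqP => // e; have := ltn_ord t; lia.
  have dN' : (dest r j < N.+1)%nat by [].
  rewrite (bigD1 (Ordinal dN')) //= eqxx big1 ?Rplus_0_r // => t /eqP td.
  by case: eqP => // e; case: td; apply: val_inj.
rewrite big_ord_recr /= big1 => [|t _].
  rewrite out // HN big1 => [|j _]; first by ring.
  by rewrite H0 ?Rmult_0_r //; have := dest_bounds N j; lia.
by rewrite out 1?ltnW ?ltnS // -Hav //; ring.
Qed.

(** * Time reversal at a fixed horizon *)

Section Horizon.
Variable N : nat.
(** The reversal [a = M - t] sends the horizon [N] to [B]. The extra [B] units make room for
    destinations beyond [N], so that the subtraction in [sigN] is never truncated on [domN]. *)
Let M := (N + B)%nat.

Let domN (a : nat) : bool := (B < a <= M)%nat.
Let cN (a : nat) (j : 'I_I) : R := A j (act (M - a)).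
Let sigN (a : nat) (j : 'I_I) : nat := (M - dest (M - a) j)%nat.

Definition push_weight (t : nat) : R := green domN cN sigN (M - t) B.

(** Column stochasticity of [A] becomes the averaging property, and edges are reversed along with
    time. *)
Lemma push_kernel :
  averaging_kernel (fun a b => E b a) mbar B domN (fun a => act (M - a)) cN sigN.
Proof.
move=> a ha; case: (Acol) => A0 A1; rewrite /domN in ha.
have hd j := dest_bounds (M - a) j.
have dM j : (dest (M - a) j <= M)%nat by have := hd j; rewrite /M in ha *; lia.
split => //.
- by move=> j; exact: A0.
- by rewrite /cN A1.
- by move=> j; have := hd j; have := dM j; rewrite /sigN /M; lia.
- move=> j hj; split; last by rewrite /sigN subKn // act_dest.
  case: (Apat) => h1 [h2 _]; rewrite /cN.
  by case/orP: hj => [/eqP <-|]; [exact: h1 | exact: h2].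
- move=> s sa e; rewrite /sigN.
  have : consumed (M - a) (act (M - a)) (M - s).
    rewrite /consumed (negbTE (nsl _)) e eqxx andbT; rewrite /M in ha *; lia.
  by move/dest_min; rewrite /M in ha *; lia.
Qed.

Lemma mass_push l : mass N l = \big[Rplus/0]_(t < N.+1) (push_weight t * injected t l).
Proof.
have ker := push_kernel.
apply: mass_duality.
- rewrite /push_weight (_ : (M - N)%nat = B); last by rewrite /M; lia.
  exact: (green_diag ker).
- by move=> t Nt; rewrite /push_weight (green_before ker) // /M; have := T_gt0; rewrite /B; lia.
- move=> t tN; rewrite /push_weight (greenE ker) (_ : (M - t == B)%nat = false); last by rewrite /M; lia.
  rewrite (_ : domN _) ?Rplus_0_l; last by rewrite /domN /M; lia.
  by apply: eq_bigr => j _; rewrite /cN /sigN subKn // /M; lia.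
Qed.

End Horizon.
End Model.

(** * Discounted sums and descent *)

Definition discounted (r : R) (a : nat -> R) (s : nat) : R :=
  \big[Rplus/0]_(t < s) (r ^ (s - t) * a t).

Section Discounted.
Variables (r : R) (a : nat -> R).
Hypothesis r01 : 0 < r < 1.

Lemma discountedS s : discounted r a s.+1 = r * (discounted r a s + a s).
Proof.
rewrite /discounted big_ord_recr /= Rmult_plus_distr_l mulr_suml subSnn /= Rmult_1_r.
congr (_ + _); apply: eq_bigr => t _.
by rewrite subSn /= ?Rmult_assoc // ltnW.
Qed.

Lemma discounted0 : discounted r a 0 = 0. Proof. exact: big_ord0. Qed.

Hypothesis a0 : forall t, 0 <= a t.

Lemma discounted_ge0 s : 0 <= discounted r a s.
Proof.
by apply: sumr_ge0 => t _; apply: Rmult_le_pos => //; apply: pow_le; lra.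
Qed.

Lemma discounted_shift s m : r ^ m * discounted r a s <= discounted r a (s + m).
Proof.
elim: m => [|m IH]; first by rewrite addn0 /=; lra.
by rewrite addnS discountedS /=; have := a0 (s + m); nra.
Qed.

(** The weights received by each [a t] form a geometric series. The induction runs on an exact
    balance that includes the boundary term [r * discounted r a N]. *)
Lemma sum_discounted N : (1 - r) * \big[Rplus/0]_(s < N) discounted r a s.+1 <=
  \big[Rplus/0]_(t < N) a t.
Proof.
suff : (1 - r) * \big[Rplus/0]_(s < N) discounted r a s.+1 + r * discounted r a N =
    r * \big[Rplus/0]_(t < N) a t.
  have : 0 <= \big[Rplus/0]_(t < N) a t by apply: sumr_ge0.
  have := discounted_ge0 N; nra.
elim: N => [|N IH]; first by rewrite !big_ord0 discounted0; ring.
rewrite sum_ordS [RHS]Rmult_plus_distr_l -IH (sum_ordS (fun s => discounted r a s.+1)).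
by rewrite discountedS; ring.
Qed.

Lemma sum_discounted_lt N : (1 - r) * \big[Rplus/0]_(s < N) discounted r a s <=
  \big[Rplus/0]_(t < N) a t.
Proof.
apply: Rle_trans (sum_discounted N); apply: Rmult_le_compat_l; first lra.
elim: N => [|N IH]; first by rewrite !big_ord0; lra.
case: N IH => [|N] IH.
  rewrite !big_ord_recr !big_ord0 /= discounted0; have := discounted_ge0 1; lra.
rewrite big_ord_recl [X in _ <= X]big_ord_recr /= discounted0 Rplus_0_l.
rewrite (eq_bigr (fun i : 'I_N.+1 => discounted r a i.+1)) //.
have := discounted_ge0 N.+2; lra.
Qed.

End Discounted.

Lemma geometric_sum_le r s : 0 < r < 1 -> (1 - r) * \big[Rplus/0]_(t < s) r ^ (s - t) <= 1.
Proof.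
move=> r01; have -> : \big[Rplus/0]_(t < s) r ^ (s - t) = discounted r (fun _ => 1) s.
  by apply: eq_bigr => t _; ring.
elim: s => [|s IH]; first by rewrite discounted0; lra.
rewrite discountedS; nra.
Qed.

(** In the weighted Cauchy-Schwarz bound, one factor is a geometric sum and the other the discounted
    sum; each costs one [/ kap]. *)
Lemma sqnorm_discounted n r kap s (lam : nat -> R) (e : nat -> vec n) (u : vec n) :
  0 < r < 1 -> 0 < kap ->
  (forall t, (t < s)%nat -> kap * Rabs (lam t) <= r ^ (s - t)) ->
  (forall l, u l = \big[Rplus/0]_(t < s) (lam t * e t l)) ->
  sqnorm u <= / (kap ^ 2 * (1 - r)) * discounted r (fun t => sqnorm (e t)) s.
Proof.
move=> r01 k0 hl hu.
have := sqnorm_sum_le (r := index_enum _) (lam := fun t : 'I_s => lam t) (e := fun t : 'I_s => e t) hu.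
set S1 := \big[_/_]_(t <- _) Rabs _; set S2 := \big[_/_]_(t <- _) (_ * _) => h.
have D0 : 0 <= discounted r (fun t => sqnorm (e t)) s.
  by apply: discounted_ge0 => // t; exact: sqnorm_ge0.
have h1 : kap * S1 <= / (1 - r).
  apply: (Rmult_le_reg_l (1 - r)); first lra.
  rewrite Rinv_r; last lra.
  apply: Rle_trans (geometric_sum_le s r01); apply: Rmult_le_compat_l; first lra.
  by rewrite mulr_suml; apply: ler_sum => t _; exact: hl.
have h2 : kap * S2 <= discounted r (fun t => sqnorm (e t)) s.
  rewrite mulr_suml; apply: ler_sum => t _; rewrite -Rmult_assoc.
  by apply: Rmult_le_compat_r; [exact: sqnorm_ge0 | exact: hl].
have S10 : 0 <= S1 by apply: sumr_ge0 => t _; exact: Rabs_pos.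
have S20 : 0 <= S2.
  by apply: sumr_ge0 => t _; apply: Rmult_le_pos; [exact: Rabs_pos | exact: sqnorm_ge0].
have key : (kap * S1) * (kap * S2) <= / (1 - r) * discounted r (fun t => sqnorm (e t)) s.
  by apply: Rmult_le_compat => //; nra.
rewrite Rinv_mult Rmult_assoc; apply: (Rmult_le_reg_l (kap ^ 2)); first nra.
rewrite -Rmult_assoc Rinv_r ?Rmult_1_l; last nra.
apply: Rle_trans key; nra.
Qed.

(** * Smoothness and the descent inequality *)

Lemma norm_scale n c (h : vec n) : norm (vscale c h) = Rabs c * norm h.
Proof.
rewrite /norm sqnorm_scale sqrt_mult; [|exact: pow2_ge_0|exact: sqnorm_ge0].
by rewrite -Rsqr_pow2 sqrt_Rsqr_abs.
Qed.

Lemma lipschitz_sqnorm n (f : vec n -> R) g L (x y : vec n) : lipschitz_differentiable f g L ->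
  sqnorm (vsub (g x) (g y)) <= L ^ 2 * sqnorm (vsub x y).
Proof.
case=> _ [L0 /(_ x y)]; rewrite /norm => h.
rewrite -(sqrt_sqrt (sqnorm (vsub (g x) _))); last exact: sqnorm_ge0.
rewrite -(sqrt_sqrt (sqnorm (vsub x y))); last exact: sqnorm_ge0.
have := sqrt_pos (sqnorm (vsub (g x) (g y))); have := sqrt_pos (sqnorm (vsub x y)); nra.
Qed.

Lemma directional_derivative n (f : vec n -> R) g (x h : vec n) t : has_gradient f g ->
  derivable_pt_lim (fun s => f (vadd x (vscale s h))) t (dot (g (vadd x (vscale t h))) h).
Proof.
move=> hg eps eps0; have nh : 0 <= norm h by exact: sqrt_pos.
(* The [+ 1] covers a direction [h] of norm 0, and the factor 2 makes the final inequality
   strict. *)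
have [del [del0 hd]] := hg (vadd x (vscale t h)) (eps / (2 * (norm h + 1)))
  ltac:(apply: Rdiv_lt_0_compat; lra).
have dp : 0 < del / (norm h + 1) by apply: Rdiv_lt_0_compat; lra.
exists (mkposreal _ dp) => s s0 /= sd.
have := hd (vscale s h); rewrite norm_scale dot_vscaler.
have -> : vadd (vadd x (vscale t h)) (vscale s h) = vadd x (vscale (t + s) h).
  by apply: functional_extensionality => l; rewrite /vadd /vscale; ring.
have sa : 0 < Rabs s by exact: Rabs_pos_lt.
have lt : Rabs s * norm h < del.
  have e : del / (norm h + 1) * (norm h + 1) = del by field; lra.
  nra.
move=> /(_ lt); set dq := f _ - f _ => le.
have -> : dq / s - dot (g (vadd x (vscale t h))) h = (dq - s * dot (g (vadd x (vscale t h))) h) / s.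
  by field.
rewrite /Rdiv Rabs_mult Rabs_inv.
apply: (Rmult_lt_reg_r (Rabs s)) => //; rewrite Rmult_assoc Rinv_l ?Rmult_1_r; last lra.
apply: Rle_lt_trans le _.
have e : eps / (2 * (norm h + 1)) * (2 * (norm h + 1)) = eps by field; lra.
have e0 : 0 < eps / (2 * (norm h + 1)) by apply: Rdiv_lt_0_compat; lra.
move: (eps / _) e e0 => q e e0; rewrite -e; nra.
Qed.

(* The mean value theorem and Young's inequality give a worse constant than the
   usual [L / 2], but need neither integration nor Cauchy-Schwarz. *)
Lemma descent_lemma n (f : vec n -> R) g L (x h : vec n) : lipschitz_differentiable f g L ->
  f (vadd x h) <= f x + dot (g x) h + (L ^ 2 + 1) / 2 * sqnorm h.
Proof.
move=> lf; have [hg _] := lf.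
have [c [hc c01]] := MVT_cor2 (fun s => f (vadd x (vscale s h)))
  (fun s => dot (g (vadd x (vscale s h))) h) 0 1 Rlt_0_1
  (fun s _ => directional_derivative x h s hg).
move: hc.
have -> : vadd x (vscale 1 h) = vadd x h.
  by apply: functional_extensionality => l; rewrite /vadd /vscale; ring.
have -> : vadd x (vscale 0 h) = x.
  by apply: functional_extensionality => l; rewrite /vadd /vscale; ring.
set y := vadd x (vscale c h) => hc.
have e : dot (g y) h = dot (g x) h + dot (vsub (g y) (g x)) h.
  by rewrite /dot -big_split /=; apply: eq_bigr => l _; rewrite /vsub; ring.
have := dot_young (vsub (g y) (g x)) h; have := lipschitz_sqnorm y x lf.
have -> : sqnorm (vsub y x) = c ^ 2 * sqnorm h.
  by rewrite -sqnorm_scale; apply: eq_sqnorm => l; rewrite /y /vsub /vadd; ring.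
have := sqnorm_ge0 h; have : 0 <= L ^ 2 by exact: pow2_ge_0.
move: (sqnorm h) (L ^ 2) hc e => q L2 hc e L20 q0 h1 h2.
have : L2 * (c ^ 2 * q) <= L2 * q.
  apply: Rmult_le_compat_l => //; have : c ^ 2 <= 1 by nra.
  nra.
lra.
Qed.

(** * Tail sums and hitting times *)

Definition sum_from (m : nat) (a : nat -> R) (N : nat) : R :=
  \big[Rplus/0]_(t < N) (if (m <= t)%nat then a t else 0).

Lemma sum_fromS m a N : sum_from m a N.+1 = sum_from m a N + (if (m <= N)%nat then a N else 0).
Proof. exact: big_ord_recr. Qed.

Lemma sum_le_tail m (a b : nat -> R) N : (forall t, 0 <= a t) ->
  (forall t, (m <= t < N)%nat -> a t <= b t) ->
  \big[Rplus/0]_(t < N) a t <= \big[Rplus/0]_(t < m) a t + sum_from m b N.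
Proof.
move=> a0 h.
have S0 : 0 <= \big[Rplus/0]_(t < m) a t by apply: sumr_ge0.
case: (leqP N m) => Nm.
  rewrite (sum_ord_widen a Nm) /sum_from [X in _ + X]big1 => [|t _]; last first.
    by rewrite leqNgt (leq_trans (ltn_ord t) Nm).
  by rewrite Rplus_0_r; apply: ler_sum => t _; case: ifP => _; [lra | exact: a0].
rewrite (sum_ord_widen a (ltnW Nm)) /sum_from -big_split /=; apply: ler_sum => t _.
case: ltnP => mt; first by lra.
by have := h t; rewrite mt ltn_ord => /(_ isT); lra.
Qed.

Lemma sum_from_le m (a b : nat -> R) N : (forall t, (m <= t < N)%nat -> a t <= b t) ->
  sum_from m a N <= sum_from m b N.
Proof.
move=> h; apply: ler_sum => t _; case: ifP => mt; last lra.
by apply: h; rewrite mt ltn_ord.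
Qed.

Lemma sum_from_lin m (a b : nat -> R) p q N :
  sum_from m (fun t => p * a t + q * b t) N = p * sum_from m a N + q * sum_from m b N.
Proof.
rewrite /sum_from !mulr_suml -big_split /=; apply: eq_bigr => t _.
by case: ifP => _; ring.
Qed.

Lemma sum_from_telescope m (u b : nat -> R) N : (m <= N)%nat ->
  (forall t, (m <= t < N)%nat -> u t.+1 <= u t + b t) -> u N <= u m + sum_from m b N.
Proof.
elim: N => [|N IH].
  by rewrite leqn0 => /eqP ->; rewrite /sum_from big_ord0; lra.
rewrite leq_eqVlt => /orP [/eqP <- _|mN h].
  rewrite /sum_from big1; first lra.
  by move=> t _; rewrite leqNgt ltn_ord.
rewrite sum_fromS (_ : (m <= N)%nat) //.
have := h N; have := IH mN (fun t ht => h t ltac:(lia)).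
by move=> h1 /(_ ltac:(lia)); lra.
Qed.

(** If the first [N] values all exceed [delta], their sum is at least [N * delta], so
    [N <= C / delta]. This gives both the existence of a hit and the bound on the first one. *)
Lemma first_hit_of_summable (M : nat -> R) C : (forall k, 0 <= M k) ->
  (forall N, \big[Rplus/0]_(k < N) M k <= C) ->
  forall delta, 0 < delta -> exists2 k, first_hit M delta k & INR k <= C / delta.
Proof.
move=> M0 hC delta d0.
have bound N : (forall k, (k < N)%nat -> delta < M k) -> INR N <= C / delta.
  move=> h; apply: (Rmult_le_reg_r delta) => //.
  rewrite /Rdiv Rmult_assoc Rinv_l ?Rmult_1_r; last lra.
  apply: Rle_trans (hC N); elim: N h => [|N IH] h; first by rewrite big_ord0 /=; lra.
  rewrite sum_ordS S_INR; have := h N (ltnSn N).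
  by have := IH (fun k hk => h k (ltnW hk)); lra.
pose hit k : bool := if Rle_dec (M k) delta then true else false.
have hitP k : reflect (M k <= delta) (hit k) by rewrite /hit; case: Rle_dec => h; constructor.
have ex : exists k, hit k.
  have [N hN] := INR_unbounded (C / delta).
  case: (boolP [exists k : 'I_N, hit k]) => [/existsP [k hk]|/existsPn nex]; first by exists k.
  have := bound N; suff h : forall k, (k < N)%nat -> delta < M k by move/(_ h); lra.
  by move=> k kN; apply: Rnot_le_lt => /hitP hk; have := nex (Ordinal kN); rewrite /= hk.
have [k /hitP hk kmin] := ex_minnP ex.
have lt j : (j < k)%nat -> delta < M j.
  move=> jk; apply: Rnot_le_lt => /hitP /kmin; lia.
by exists k; [split | exact: bound].
Qed.

(** * Convergence *)

Lemma sum_const m c : \big[Rplus/0]_(i < m) c = INR m * c.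
Proof.
elim: m => [|m IH]; first by rewrite big_ord0 /=; ring.
by rewrite (sum_ordS (fun _ => c)) IH S_INR; ring.
Qed.

Lemma dot_young_scaled n t (u w : vec n) : 0 < t ->
  - dot u w <= t / 2 * sqnorm u + / (2 * t) * sqnorm w.
Proof.
move=> t0; have := dot_young (vscale (- t) u) w; rewrite sqnorm_scale => h.
have e : dot (vscale (- t) u) w = - t * dot u w.
  by rewrite /dot mulr_suml; apply: eq_bigr => l _; rewrite /vscale; ring.
apply: (Rmult_le_reg_l t) => //.
have -> : t * (t / 2 * sqnorm u + / (2 * t) * sqnorm w) =
  / 2 * ((- t) ^ 2 * sqnorm u) + / 2 * sqnorm w by field; lra.
lra.
Qed.

(* The small-gain argument: [Qq] collects the squared consensus and tracking
   errors, [Z] the squared update directions, [Aa] the squared gradients. *)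
Lemma closed_loop_bound al be Ce C1 Lam C0 Del gam Aa Qq Z :
  0 < al -> 0 <= be -> 0 <= Ce -> 0 <= C1 -> 0 <= Lam -> 0 <= C0 ->
  0 < gam <= 1 -> gam * (4 * C1 * Ce) <= 1 -> gam * (16 * (be * Ce * C1)) <= al ->
  gam * (16 * Lam) <= al -> 0 <= Aa -> 0 <= Qq ->
  Z <= 2 * Aa + 2 * Ce * Qq -> Qq <= C0 + C1 * gam ^ 2 * Z ->
  gam * al * Aa <= Del + gam * (be * Ce) * Qq + Lam * gam ^ 2 * Z ->
  gam * al * Aa <= 2 * (Del + 2 * (be * Ce * C0) + 4 * (Lam * Ce * C0)) /\
  Qq <= 2 * C0 + 4 * C1 * Aa.
Proof.
move=> al0 be0 Ce0 C10 Lam0 C00 g01 s1 s2 s3 A0 Q0 hZ hQ hA.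
have g2 : 0 <= gam ^ 2 <= gam by nra.
have m1 : 0 <= C1 * Ce by exact: Rmult_le_pos.
have m2 : 0 <= be * Ce by exact: Rmult_le_pos.
have m3 : 0 <= be * Ce * C1 by exact: Rmult_le_pos.
have m4 : 0 <= Ce * C0 by exact: Rmult_le_pos.
have m5 : 0 <= C1 * Aa by exact: Rmult_le_pos.
have t1 : gam ^ 2 * (4 * (C1 * Ce)) <= 1 by nra.
have t2 : gam ^ 2 * (16 * (be * Ce * C1)) <= al by nra.
(* The first step-size condition limits the feedback of [Qq] on itself through [Z] to one half,
   which can then be absorbed. *)
have hQ1 : Qq <= C0 + 2 * (C1 * gam ^ 2 * Aa) + Qq / 2.
  have : C1 * gam ^ 2 * Z <= C1 * gam ^ 2 * (2 * Aa + 2 * Ce * Qq).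
    by apply: Rmult_le_compat_l => //; apply: Rmult_le_pos; lra.
  have : (gam ^ 2 * (4 * (C1 * Ce))) * Qq <= 1 * Qq by apply: Rmult_le_compat_r.
  lra.
have hQ2 : Qq <= 2 * C0 + 4 * (C1 * gam ^ 2 * Aa) by lra.
have hQ3 : Qq <= 2 * C0 + 4 * C1 * Aa.
  have : gam ^ 2 * (C1 * Aa) <= 1 * (C1 * Aa) by apply: Rmult_le_compat_r; lra.
  lra.
have hZ2 : Z <= 4 * Aa + 4 * (Ce * C0).
  have : Ce * Qq <= Ce * (2 * C0 + 4 * (C1 * gam ^ 2 * Aa)) by apply: Rmult_le_compat_l.
  have : (gam ^ 2 * (4 * (C1 * Ce))) * Aa <= 1 * Aa by apply: Rmult_le_compat_r.
  lra.
have gA : 0 <= gam * Aa by apply: Rmult_le_pos; lra.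
(* [b1] and [b2] each use a quarter of the descent term [gam * al * Aa]; the remaining half explains
   the factor 2 in the conclusion. *)
have b1 : gam * (be * Ce) * Qq <= 2 * (be * Ce * C0) + al / 4 * (gam * Aa).
  have : gam * (be * Ce) * Qq <= gam * (be * Ce) * (2 * C0 + 4 * (C1 * gam ^ 2 * Aa)).
    by apply: Rmult_le_compat_l => //; apply: Rmult_le_pos; lra.
  have : (gam ^ 2 * (16 * (be * Ce * C1))) * (gam * Aa) <= al * (gam * Aa).
    exact: Rmult_le_compat_r.
  have : gam * (be * Ce * C0) <= 1 * (be * Ce * C0).
    by apply: Rmult_le_compat_r; [exact: Rmult_le_pos | lra].
  lra.
have b2 : Lam * gam ^ 2 * Z <= al / 4 * (gam * Aa) + 4 * (Lam * Ce * C0).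
  have : Lam * gam ^ 2 * Z <= Lam * gam ^ 2 * (4 * Aa + 4 * (Ce * C0)).
    by apply: Rmult_le_compat_l => //; apply: Rmult_le_pos; lra.
  have : (gam * (16 * Lam)) * (gam * Aa) <= al * (gam * Aa) by exact: Rmult_le_compat_r.
  have : gam ^ 2 * (Lam * (Ce * C0)) <= 1 * (Lam * (Ce * C0)).
    by apply: Rmult_le_compat_r; [exact: Rmult_le_pos | lra].
  lra.
split=> //; lra.
Qed.

Section Convergence.
Variables (n I : nat) (E : rel 'I_I) (W A : 'I_I -> 'I_I -> R) (mbar : R) (T D P : nat).
Variables (f : 'I_I -> vec n -> R) (g : 'I_I -> vec n -> vec n) (L : 'I_I -> R).
Hypothesis nsl : no_self_loops E.
Hypothesis mb01 : 0 < mbar < 1.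
Hypotheses (Wrow : row_stochastic W) (Wpat : weight_pattern E mbar W).
Hypotheses (Acol : col_stochastic A) (Apat : weight_pattern E mbar A).
Hypothesis Lip : forall i, lipschitz_differentiable (f i) (g i) (L i).
Hypothesis EP : forall i j, exists2 p, (p <= P)%nat & reach E p i j.
Hypothesis T0 : (0 < T)%nat.

Let B := (T + T + D)%nat.
Let K := (P * B + B)%nat.
Let eta := mbar ^ K.
Let r := 1 - eta / INR K.
(** The total loss of exponent in the decay estimates: [K] for an incomplete block, [B + T.+1] for
    the lag of the observation time, and [B] for the start of the averaging recursion. *)
Let kap := r ^ (K + (B + T.+1) + B).
Let CY := / (kap ^ 2 * (1 - r)).
Let Lc := \big[Rplus/0]_i (L i ^ 2).
Let Lam := \big[Rplus/0]_i ((L i ^ 2 + 1) / 2).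
Let Ce := 2 * CY * (/ r ^ T + INR I * (INR I * Lc)).
Let th := mbar * eta.
(** From here on, the last activation before the current time is itself at least [B + P * B], late
    enough for averaging and for the lower bound on the tracking weight. *)
Let s0 := (B + T + P * B)%nat.

Lemma B_gt0 : (0 < B)%nat. Proof. rewrite /B; lia. Qed.
Lemma eta01 : 0 < eta < 1. Proof. exact: (eta_bounds P mb01 B_gt0). Qed.
Lemma r01 : 0 < r < 1. Proof. exact: (rho_bounds P mb01 B_gt0). Qed.
Lemma kap_gt0 : 0 < kap. Proof. apply: pow_lt; have := r01; lra. Qed.
Lemma CY_gt0 : 0 < CY.
Proof.
apply: Rinv_0_lt_compat; apply: Rmult_lt_0_compat; last by have := r01; lra.
exact: pow_lt kap_gt0.
Qed.
Lemma Lc_ge0 : 0 <= Lc. Proof. by apply: sumr_ge0 => i _; exact: pow2_ge_0. Qed.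
Lemma Lam_ge0 : 0 <= Lam.
Proof. by apply: sumr_ge0 => i _; have := pow2_ge_0 (L i); lra. Qed.
Lemma Ce_ge0 : 0 <= Ce.
Proof.
have hr : 0 < / r ^ T by apply: Rinv_0_lt_compat; apply: pow_lt; have := r01; lra.
have hI : 0 <= INR I * (INR I * Lc).
  by do 2 (apply: Rmult_le_pos; first exact: pos_INR); exact: Lc_ge0.
by have := CY_gt0; rewrite /Ce; nra.
Qed.
Lemma th_bounds : 0 < th < 1. Proof. rewrite /th; have := eta01; nra. Qed.

Definition objective (y : vec n) : R := \big[Rplus/0]_i f i y.
Definition gradient (y : vec n) : vec n := vsum predT (fun i => g i y).

Lemma lip_sqnorm i u w : sqnorm (vsub (g i u) (g i w)) <= Lc * sqnorm (vsub u w).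
Proof.
apply: Rle_trans (lipschitz_sqnorm u w (Lip i)) _.
apply: Rmult_le_compat_r; first exact: sqnorm_ge0.
rewrite /Lc (bigD1 i) //= -[X in X <= _]Rplus_0_r; apply: Rplus_le_compat_l.
by apply: sumr_ge0 => j _; exact: pow2_ge_0.
Qed.

Lemma gradient_sum_lip (u : 'I_I -> vec n) w M : (forall i, sqnorm (vsub (u i) w) <= M) ->
  sqnorm (vsub (vsum predT (fun i => g i (u i))) (gradient w)) <= INR I * (INR I * (Lc * M)).
Proof.
move=> hM.
rewrite (@eq_sqnorm _ _ (vsum predT (fun i => vsub (g i (u i)) (g i w)))); last first.
  by move=> l; rewrite /gradient /vsub /vsum sumrB.
apply: Rle_trans (sqnorm_vsum_le _) _; rewrite card_ord.
apply: Rmult_le_compat_l; first exact: pos_INR.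
rewrite -sum_const; apply: ler_sum => i _; apply: Rle_trans (lip_sqnorm _ _ _) _.
by apply: Rmult_le_compat_l => //; exact: Lc_ge0.
Qed.

Lemma objective_descent y h :
  objective (vadd y h) <= objective y + dot (gradient y) h + Lam * sqnorm h.
Proof.
have -> : dot (gradient y) h = \big[Rplus/0]_i dot (g i y) h.
  rewrite /dot exchange_big /=; apply: eq_bigr => l _.
  by rewrite Rmult_comm mulr_suml; apply: eq_bigr => i _; ring.
rewrite /Lam Rmult_comm mulr_suml /objective -!big_split /=; apply: ler_sum => i _.
by rewrite (Rmult_comm (sqnorm h)); exact: descent_lemma.
Qed.

(** * Estimates along one trajectory, with constants independent of it *)

Section Trajectory.
Variables (gam : R) (act : nat -> 'I_I) (d : nat -> 'I_I -> nat).
Variables (x z : nat -> 'I_I -> vec n) (v : Z -> 'I_I -> vec n)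
  (rho : Z -> 'I_I -> 'I_I -> vec n) (rt : nat -> 'I_I -> 'I_I -> vec n)
  (tau : nat -> 'I_I -> 'I_I -> Z).
Hypothesis async : asynchrony_model E T D act d.
Hypothesis alg : asy_sonata E W A D g gam act d x z v rho rt tau.

Let G := green (fun k => (B <= k)%nat) (fun k j => W (act k) j)
  (fun k j => source_time E act tau k (act k) j).
Let Y := sent act v.
Let m := mass E g act x z rho rt tau.
Let inj := injected async alg.
Let kerY := consensus_kernel nsl Wrow Wpat async alg.

Definition innovation (t : nat) : vec n := fun l => Y t l -
  (if (B <= t)%nat then \big[Rplus/0]_j (W (act t) j * Y (source_time E act tau t (act t) j) l)
   else 0).

(* The value that all agents would agree on, as seen at time [N], if the
   gradient steps were switched off from time [s] on. *)
Definition virtual (N s : nat) : vec n :=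
  fun l => \big[Rplus/0]_(t < s) (G N t * innovation t l).

Let QY := discounted r (fun t => sqnorm (innovation t)).
Let Qm := discounted r (fun t => sqnorm (inj t)).

Lemma QY_ge0 s : 0 <= QY s.
Proof. by apply: (discounted_ge0 r01) => t; exact: sqnorm_ge0. Qed.

Lemma Qm_ge0 s : 0 <= Qm s.
Proof. by apply: (discounted_ge0 r01) => t; exact: sqnorm_ge0. Qed.

Lemma innovationE t l : (B <= t)%nat -> innovation t l = - gam * z t (act t) l.
Proof.
move=> Bt; rewrite /innovation Bt -(x_average nsl Wpat async alg) //.
by rewrite /Y (sentE alg); ring.
Qed.

Lemma virtualS N s l : (B <= s)%nat ->
  virtual N s.+1 l = virtual N s l - G N s * gam * z s (act s) l.
Proof.
move=> Bs; rewrite /virtual (sum_ordS (fun t => G N t * innovation t l)) innovationE //; ring.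
Qed.

Lemma sent_superposition k s l : (k < s)%nat -> Y k l = virtual k s l.
Proof.
move=> ks; apply: (green_superposition kerY (y := fun k => Y k l) (e := innovation^~ l)) => // t.
by rewrite /innovation -/B -/Y; case: (B <= t)%nat; ring.
Qed.

Lemma G_bounds k t : 0 <= G k t <= 1. Proof. exact: (green_bounds kerY). Qed.

Lemma G_lower N s : (B <= s)%nat -> (s + P * B <= N)%nat -> eta <= G N s.
Proof.
move=> Bs sN; apply: (green_lower_bound mb01 B_gt0 EP kerY (h := N)).
  by move=> k hk; lia.
by rewrite sN leqnn.
Qed.

Lemma G_decay N k s t : (t < s)%nat -> (k < s <= k + (B + T.+1))%nat -> (k <= N)%nat ->
  kap * Rabs (G k t - G N t) <= r ^ (s - t).
Proof.
move=> ts ks kN; have hr := r01; have hB := B_gt0.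
(* The impulse response averages only after its source [t] and only at times from [B] on. *)
pose q := maxn t B.-1.
have hq : (t <= q)%nat /\ (B.-1 <= q)%nat /\ (q <= t + B)%nat by rewrite /q; lia.
have rp a : 0 <= r ^ a by apply: pow_le; lra.
case: (leqP q k) => qk.
  have h := @green_decay _ _ _ _ _ mb01 B_gt0 EP _ _ _ _ kerY t q N k k N
    ltac:(lia) ltac:(move=> i hi; lia) ltac:(lia) ltac:(lia) ltac:(lia) ltac:(lia) ltac:(lia).
  apply: (Rle_trans _ (r ^ (B + T.+1 + B) * r ^ (k - q))).
    rewrite /kap -addnA -plusE pow_add (Rmult_comm (r ^ K)) Rmult_assoc.
    exact: Rmult_le_compat_l.
  by rewrite -pow_add plusE; apply: pow_mono; [lra | lia].
(* Here [s - t] is bounded by the exponent of [kap], so the trivial bound 1 on the difference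
   suffices. *)
apply: (Rle_trans _ (kap * 1)).
  apply: Rmult_le_compat_l; first by have := kap_gt0; lra.
  by apply: Rabs_le; have := G_bounds k t; have := G_bounds N t; lra.
by rewrite Rmult_1_r; apply: pow_mono; [lra | lia].
Qed.

(** Each vector averaged in [x s i] is the same superposition of innovations as [virtual N q], seen
    at another observation time. The slack in [q] allows an iterate from the last activation to be
    compared with the current virtual point. *)
Lemma consensus_error N s q i : (B <= s)%nat -> (s <= q <= s + T.+1)%nat -> (q <= N)%nat ->
  sqnorm (vsub (x s i) (virtual N q)) <= CY * QY q.
Proof.
move=> Bs sq qN; have [W0 W1] := Wrow.
apply: (@sqnorm_convex_le _ _ (W i) (fun j => Y (source_time E act tau s i j))) => //.
  by move=> l; exact: (x_average nsl Wpat async alg).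
move=> j; have hs := source_time_bounds async alg i j Bs.
set k := source_time _ _ _ _ _ _ in hs *.
apply: (@sqnorm_discounted _ r kap q (fun t => G k t - G N t) innovation _ r01 kap_gt0).
  by move=> t tq; apply: G_decay => //; rewrite /B in hs *; lia.
move=> l; rewrite /vsub (sent_superposition (s := q)); last lia.
by rewrite /virtual -sumrB; apply: eq_bigr => t _; ring.
Qed.

Lemma injected_bound t : (B <= t)%nat -> sqnorm (inj t) <= 4 * Lc * CY * QY t.+1.
Proof.
move=> Bt; have h1 := @consensus_error t.+1 t.+1 t.+1 (act t) ltac:(lia) ltac:(lia) ltac:(lia).
have h2 := @consensus_error t.+1 t t.+1 (act t) ltac:(lia) ltac:(lia) ltac:(lia).
rewrite (@eq_sqnorm _ _ (vsub (g (act t) (x t.+1 (act t))) (g (act t) (x t (act t))))).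
  apply: Rle_trans (lip_sqnorm _ _ _) _.
  have -> : 4 * Lc * CY * QY t.+1 = Lc * (2 * (CY * QY t.+1) + 2 * (CY * QY t.+1)) by ring.
  apply: Rmult_le_compat_l; first exact: Lc_ge0.
  by have := sqnorm_sub_trans (virtual t.+1 t.+1) (x t.+1 (act t)) (x t (act t)); lra.
move=> l; rewrite /inj (injectedE nsl Apat) /= (acted_window async); last by rewrite /B in Bt; lia.
by rewrite /vsub; ring.
Qed.

(** Injections in the remote past all enter [mass N] with nearly the weight [xi] of the oldest one.
    Replacing every weight by [xi] leaves [xi] times the sum of all injections, which is the sum of
    the current gradients once all agents have acted. *)
Lemma tracking_error N : (T <= N.+1)%nat -> exists xi, [/\ 0 <= xi <= 1,
  (P * B <= N)%nat -> eta <= xi &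
  sqnorm (vsub (m N) (vscale xi (vsum predT (fun i => g i (x N.+1 i))))) <= CY * Qm N.+1].
Proof.
move=> TN; have hr := r01; have hB := B_gt0.
have ker := push_kernel nsl Acol Apat async alg (N := N); rewrite -/B in ker.
have EP' i j : exists2 p, (p <= P)%nat & reach (fun a b => E b a) p i j.
  by have [p pP /reach_converse h] := EP j i; exists p.
exists (push_weight async alg N 0); split.
- exact: (green_bounds ker).
- move=> hN; rewrite /push_weight -/B; apply: (green_lower_bound mb01 B_gt0 EP' ker (h := (N + B)%nat)).
    by move=> k hk; lia.
  by lia.
apply: (@sqnorm_discounted _ r kap N.+1
  (fun t => push_weight async alg N t - push_weight async alg N 0) inj _ r01 kap_gt0).
  move=> t tN; rewrite /push_weight -/B.
  have h := @green_decay _ _ _ _ _ mb01 B_gt0 EP' _ _ _ _ ker B B (N + B)%nat (N + B - t)%nat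
    (N + B - t)%nat (N + B - 0)%nat
    ltac:(lia) ltac:(move=> i hi; lia) ltac:(lia) ltac:(lia) ltac:(lia) ltac:(lia) ltac:(lia).
  rewrite -/K -/r -/eta in h.
  apply: (Rle_trans _ (r ^ (B + T.+1 + B) * r ^ (N + B - t - B))).
    rewrite /kap -addnA -plusE pow_add (Rmult_comm (r ^ K)) Rmult_assoc.
    by apply: Rmult_le_compat_l; [apply: pow_le; lra | exact: h].
  by rewrite -pow_add plusE; apply: pow_mono; [lra | lia].
move=> l; rewrite /vsub /vscale /m (mass_push nsl Acol Apat async alg).
have -> : vsum predT (fun i => g i (x N.+1 i)) l = \big[Rplus/0]_(t < N.+1) inj t l.
  rewrite (sum_injected nsl Apat); apply: eq_bigr => i _.
  by rewrite (acted_window async).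
by rewrite mulr_suml -sumrB; apply: eq_bigr => t _; rewrite /inj; ring.
Qed.

Lemma A_diag_bounds i : mbar <= A i i <= 1.
Proof.
case: (Apat) => h _; split=> //; case: (Acol) => A0 A1.
rewrite -(A1 i) (bigD1 i) //= -[X in X <= _]Rplus_0_r; apply: Rplus_le_compat_l.
by apply: sumr_ge0.
Qed.

Lemma direction_error N s : (s0 <= s)%nat -> (s <= N)%nat -> exists theta, th <= theta <= 1 /\
  sqnorm (vsub (z s (act s)) (vscale theta (gradient (virtual N s)))) <= Ce * (QY s + Qm s).
Proof.
move=> hs sN; have hr := r01; have hB := B_gt0; rewrite /s0 in hs.
have [p1 p2] := @last_window _ _ _ _ _ _ async s (act s) ltac:(lia).
set i := act s in p1 p2 *; set p := last_act act s i in p1 p2 *.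
have [xi [xi01 xil herr]] := @tracking_error p ltac:(rewrite /B in hs; lia).
have ha := A_diag_bounds i; have he := eta01.
have {}xil : eta <= xi by apply: xil; lia.
(* The active agent holds the fraction [A i i] of the mass of its last activation [p], and that mass
   tracks [xi] times the gradient sum. *)
exists (A i i * xi); split; first by rewrite /th; nra.
have hg := @gradient_sum_lip (x p.+1) (virtual N s) (CY * QY s)
  (fun j => @consensus_error N p.+1 s j ltac:(lia) ltac:(lia) sN).
have hQ : Qm p.+1 <= / r ^ T * Qm s.
  have rT : 0 < r ^ T by apply: pow_lt; lra.
  apply: (Rmult_le_reg_l (r ^ T)) => //; rewrite -Rmult_assoc Rinv_r ?Rmult_1_l; last lra.
  have := @discounted_shift r (fun t => sqnorm (inj t)) r01 (fun t => sqnorm_ge0 (inj t)) p.+1 (s - p.+1).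
  rewrite subnKC; last lia.
  apply: Rle_trans; apply: Rmult_le_compat_r; first exact: Qm_ge0.
  by apply: pow_mono; [lra | lia].
have := @sqnorm_le2 _ (vsub (z s i) (vscale (A i i * xi) (gradient (virtual N s))))
  (vscale (A i i) (vsub (m p) (vscale xi (vsum predT (fun i => g i (x p.+1 i))))))
  (vscale (A i i * xi) (vsub (vsum predT (fun i => g i (x p.+1 i))) (gradient (virtual N s)))).
rewrite !sqnorm_scale => h; apply: Rle_trans (h _) _.
  move=> l; rewrite (z_last alg); last by apply: (acted_window async); lia.
  by rewrite /vscale /vsub -/m -/p; ring.
have hCY := CY_gt0.
have a1 : 0 <= A i i ^ 2 <= 1 by nra.
have a2 : 0 <= (A i i * xi) ^ 2 <= 1.
  have : 0 <= A i i * xi <= 1 by nra.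
  nra.
have q1 : sqnorm (vsub (m p) (vscale xi (vsum predT (fun i => g i (x p.+1 i))))) <=
    CY * (/ r ^ T * Qm s).
  apply: Rle_trans herr _; apply: Rmult_le_compat_l; lra.
have n1 := sqnorm_ge0 (vsub (m p) (vscale xi (vsum predT (fun i => g i (x p.+1 i))))).
have n2 := sqnorm_ge0 (vsub (vsum predT (fun i => g i (x p.+1 i))) (gradient (virtual N s))).
move: (sqnorm (vsub (m p) _)) (sqnorm (vsub (vsum _ _) _)) q1 n1 n2 hg => E1 E2 q1 n1 n2 hg.
have b1 : A i i ^ 2 * E1 <= CY * (/ r ^ T * Qm s) by nra.
have b2 : (A i i * xi) ^ 2 * E2 <= INR I * (INR I * (Lc * (CY * QY s))) by nra.
have c1 : 0 <= CY * / r ^ T * QY s.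
  apply: Rmult_le_pos; last exact: QY_ge0.
  apply: Rmult_le_pos; [lra | apply: Rlt_le; apply: Rinv_0_lt_compat; apply: pow_lt; lra].
have c2 : 0 <= CY * (INR I * (INR I * Lc)) * Qm s.
  apply: Rmult_le_pos; last exact: Qm_ge0.
  apply: Rmult_le_pos; first lra.
  by do 2 (apply: Rmult_le_pos; first exact: pos_INR); exact: Lc_ge0.
rewrite /Ce; lra.
Qed.

Lemma direction_bound N s : (s0 <= s)%nat -> (s <= N)%nat ->
  sqnorm (z s (act s)) <=
  2 * sqnorm (gradient (virtual N s)) + 2 * Ce * (QY s + Qm s).
Proof.
move=> hs sN; have [theta [ht he]] := direction_error hs sN; have hth := th_bounds.
have := @sqnorm_le2 _ (z s (act s)) (vscale theta (gradient (virtual N s)))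
  (vsub (z s (act s)) (vscale theta (gradient (virtual N s)))).
rewrite sqnorm_scale => h; apply: Rle_trans (h _) _.
  by move=> l; rewrite /vsub; ring.
have : theta ^ 2 * sqnorm (gradient (virtual N s)) <= 1 * sqnorm (gradient (virtual N s)).
  by apply: Rmult_le_compat_r; [exact: sqnorm_ge0 | nra].
lra.
Qed.

(** The effective step is [gam * G N s]; keeping [N] at distance [P * B] ensures [G N s >= eta], so
    a fixed share of the descent remains. Young's inequality with parameter [theta] spends half of
    it on the direction error. *)
Lemma objective_step N s : 0 < gam -> (s0 <= s)%nat -> (s + P * B <= N)%nat ->
  objective (virtual N s.+1) <= objective (virtual N s) +
    (- (gam * (eta * th / 2)) * sqnorm (gradient (virtual N s)) +
     gam * (/ (2 * th) * Ce) * (QY s + Qm s) + Lam * gam ^ 2 * sqnorm (z s (act s))).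
Proof.
move=> g0 hs sN; have hth := th_bounds; have het := eta01.
have [theta [ht he]] := @direction_error N s hs ltac:(lia).
have Gl := @G_lower N s ltac:(rewrite /s0 in hs; lia) sN; have Gb := G_bounds N s.
have -> : virtual N s.+1 = vadd (virtual N s) (vscale (- (G N s * gam)) (z s (act s))).
  apply: functional_extensionality => l; rewrite virtualS; last by rewrite /s0 in hs; lia.
  by rewrite /vadd /vscale; ring.
apply: Rle_trans (objective_descent _ _) _.
rewrite dot_vscaler sqnorm_scale Rplus_assoc; apply: Rplus_le_compat_l.
set a := gradient _ in he *; set zs := z s (act s) in he *; set e := vsub zs _ in he.
have dz : dot a zs = theta * sqnorm a + dot a e.
  rewrite /sqnorm /dot mulr_suml -big_split /=; apply: eq_bigr => l _.
  by rewrite /e /vsub /vscale; ring.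
have yo := @dot_young_scaled _ theta a e ltac:(lra).
have a0 := sqnorm_ge0 a; have e0 := sqnorm_ge0 e; have z0 := sqnorm_ge0 zs.
have q0 : 0 <= QY s + Qm s by have := QY_ge0 s; have := Qm_ge0 s; lra.
have iv : 0 < / (2 * theta) <= / (2 * th).
  split; first by apply: Rinv_0_lt_compat; lra.
  by apply: Rinv_le_contravar; lra.
have d1 : - dot a zs <= - (th / 2) * sqnorm a + / (2 * th) * (Ce * (QY s + Qm s)).
  have : / (2 * theta) * sqnorm e <= / (2 * th) * (Ce * (QY s + Qm s)).
    by apply: Rmult_le_compat; lra.
  have : th * sqnorm a <= theta * sqnorm a by apply: Rmult_le_compat_r; lra.
  rewrite dz; lra.
have c0 : 0 <= / (2 * th) * (Ce * (QY s + Qm s)).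
  apply: Rmult_le_pos; first lra.
  by apply: Rmult_le_pos => //; exact: Ce_ge0.
have d2 : G N s * - dot a zs <= - (eta * th / 2) * sqnorm a + / (2 * th) * (Ce * (QY s + Qm s)).
  apply: (Rle_trans _ (G N s * (- (th / 2) * sqnorm a + / (2 * th) * (Ce * (QY s + Qm s))))).
    by apply: Rmult_le_compat_l; lra.
  have : eta * (th / 2 * sqnorm a) <= G N s * (th / 2 * sqnorm a).
    by apply: Rmult_le_compat_r => //; apply: Rmult_le_pos; lra.
  have : G N s * (/ (2 * th) * (Ce * (QY s + Qm s))) <= 1 * (/ (2 * th) * (Ce * (QY s + Qm s))).
    by apply: Rmult_le_compat_r; lra.
  lra.
have d3 : gam * (G N s * - dot a zs) <=
    gam * (- (eta * th / 2) * sqnorm a + / (2 * th) * (Ce * (QY s + Qm s))).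
  by apply: Rmult_le_compat_l; lra.
have d4 : (- (G N s * gam)) ^ 2 * sqnorm zs <= gam ^ 2 * sqnorm zs.
  apply: Rmult_le_compat_r => //.
  have : G N s ^ 2 <= 1 by nra.
  have := pow2_ge_0 gam; nra.
have d5 : Lam * ((- (G N s * gam)) ^ 2 * sqnorm zs) <= Lam * (gam ^ 2 * sqnorm zs).
  by apply: Rmult_le_compat_l => //; exact: Lam_ge0.
lra.
Qed.

Let CM := 2 * (INR I * (INR I * (Lc * CY))) + INR I * (4 * CY).

Lemma CM_ge0 : 0 <= CM.
Proof.
have hC := CY_gt0; have hI := pos_INR I; have hL := Lc_ge0.
have : 0 <= INR I * (INR I * (Lc * CY)).
  by do 3 (apply: Rmult_le_pos => //); lra.
have : 0 <= INR I * (4 * CY) by apply: Rmult_le_pos => //; lra.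
rewrite /CM; lra.
Qed.

Lemma merit_bound N s : (s0 <= s)%nat -> (s <= N)%nat ->
  merit g (x s) <= 2 * sqnorm (gradient (virtual N s)) + CM * (QY s + Qm s).
Proof.
move=> hs sN; rewrite /s0 in hs.
have I0 : 0 < INR I by apply: lt_0_INR; have := ltn_ord (act 0); lia.
have hx i := @consensus_error N s s i ltac:(lia) ltac:(lia) sN.
have hb : sqnorm (vsub (xbar (x s)) (virtual N s)) <= CY * QY s.
  apply: (@sqnorm_convex_le _ _ (fun=> / INR I) (x s)) => //.
  - by move=> i; apply: Rlt_le; apply: Rinv_0_lt_compat.
  - by rewrite sum_const Rinv_r; lra.
  - by move=> l; rewrite /xbar /vscale /vsum mulr_suml.
have hC := CY_gt0; have q1 := QY_ge0 s; have q2 := Qm_ge0 s; have hL := Lc_ge0.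
have p1 : 0 <= INR I * (INR I * (Lc * CY)).
  by do 3 (apply: Rmult_le_pos; try lra).
have p2 : 0 <= INR I * (4 * CY) by apply: Rmult_le_pos; lra.
have a0 := sqnorm_ge0 (gradient (virtual N s)).
have m0 := Rmult_le_pos _ _ CM_ge0 q2.
apply: Rmax_lub.
  have hg := @gradient_sum_lip (fun=> xbar (x s)) (virtual N s) _ (fun=> hb).
  have := @sqnorm_le2 _ (vsum predT (fun i => g i (xbar (x s)))) (gradient (virtual N s))
    (vsub (vsum predT (fun i => g i (xbar (x s)))) (gradient (virtual N s)))
    ltac:(by move=> l; rewrite /vsub; ring).
  have := Rmult_le_pos _ _ p2 q1.
  rewrite /CM in m0 *; lra.
apply: (Rle_trans _ (INR I * (4 * CY * QY s))).
  rewrite -sum_const; apply: ler_sum => i _.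
  by have := sqnorm_sub_trans (virtual N s) (x s i) (xbar (x s)); have := hx i; lra.
have := Rmult_le_pos _ _ p1 q1.
rewrite /CM in m0 *; lra.
Qed.

(** The virtual point depends on the horizon, but stays within a distance independent of [N] from
    one actual iterate [w]; the uniformity matters because [N] will grow with the summation
    range. *)
Lemma virtual_start_bound : exists F0, forall N, (s0 <= N)%nat -> objective (virtual N s0) <= F0.
Proof.
pose w := x s0 (act 0).
exists (objective w + (/ 2 * sqnorm (gradient w) + / 2 * (CY * QY s0)) + Lam * (CY * QY s0)) => N hN.
have h := @consensus_error N s0 s0 (act 0) ltac:(rewrite /s0; lia) ltac:(lia) hN.
rewrite -/w sqnorm_subC in h.
have -> : virtual N s0 = vadd w (vsub (virtual N s0) w).
  by apply: functional_extensionality => l; rewrite /vadd /vsub; ring.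
apply: Rle_trans (objective_descent _ _) _.
have := dot_young (gradient w) (vsub (virtual N s0) w).
have : Lam * sqnorm (vsub (virtual N s0) w) <= Lam * (CY * QY s0).
  by apply: Rmult_le_compat_l => //; exact: Lam_ge0.
lra.
Qed.

Let c := / (1 - r).
Let C1 := c + 4 * Lc * CY * (c * c).
Let C0 := (c + 4 * Lc * CY * (c * c)) * \big[Rplus/0]_(t < s0) sqnorm (innovation t) +
  c * \big[Rplus/0]_(t < s0) sqnorm (inj t).

(** After the start-up phase, innovations are steps [- gam * z], and injections are controlled by
    the consensus error they cause. Summing the discounts turns this chain into a bound by [gam ^ 2]
    times the squared directions. *)
Lemma error_sum_bound N :
  sum_from s0 (fun s => QY s + Qm s) N <=
  C0 + C1 * gam ^ 2 * sum_from s0 (fun s => sqnorm (z s (act s))) N.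
Proof.
have hr := r01.
have c0 : 0 < c by apply: Rinv_0_lt_compat; lra.
have hL : 0 <= 4 * Lc * CY.
  by apply: Rmult_le_pos; [have := Lc_ge0; lra | have := CY_gt0; lra].
set Z := sum_from s0 (fun s => sqnorm _) N.
pose E0 := \big[Rplus/0]_(t < s0) sqnorm (innovation t).
pose J0 := \big[Rplus/0]_(t < s0) sqnorm (inj t).
have divc a b : (1 - r) * a <= b -> a <= c * b.
  move=> h; apply: (Rmult_le_reg_l (1 - r)); first lra.
  by rewrite -Rmult_assoc Rinv_r ?Rmult_1_l //; lra.
have eb : \big[Rplus/0]_(t < N) sqnorm (innovation t) <= E0 + gam ^ 2 * Z.
  have -> : gam ^ 2 * Z = sum_from s0 (fun s => gam ^ 2 * sqnorm (z s (act s))) N.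
    by rewrite /Z /sum_from mulr_suml; apply: eq_bigr => t _; case: ifP => _; ring.
  apply: (sum_le_tail (a := fun t => sqnorm (innovation t))) => t; first exact: sqnorm_ge0.
  move=> ht; rewrite (_ : gam ^ 2 = (- gam) ^ 2); last by ring.
  rewrite -sqnorm_scale; apply: Req_le; apply: eq_sqnorm => l.
  by rewrite innovationE //; rewrite /s0 in ht; lia.
have i0 t : 0 <= sqnorm (innovation t) by exact: sqnorm_ge0.
have j0 t : 0 <= sqnorm (inj t) by exact: sqnorm_ge0.
have y1 : \big[Rplus/0]_(s < N) QY s <= c * (E0 + gam ^ 2 * Z).
  by apply: divc; apply: Rle_trans (sum_discounted_lt r01 i0 N) eb.
have y2 : \big[Rplus/0]_(s < N) QY s.+1 <= c * (E0 + gam ^ 2 * Z).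
  by apply: divc; apply: Rle_trans (sum_discounted r01 i0 N) eb.
have jb : \big[Rplus/0]_(t < N) sqnorm (inj t) <= J0 + 4 * Lc * CY * (c * (E0 + gam ^ 2 * Z)).
  apply: (Rle_trans _ (J0 + sum_from s0 (fun t => 4 * Lc * CY * QY t.+1) N)).
    apply: (sum_le_tail (a := fun t => sqnorm (inj t))) => // t ht; apply: injected_bound; rewrite /s0 in ht; lia.
  apply: Rplus_le_compat_l.
  apply: (Rle_trans _ (4 * Lc * CY * \big[Rplus/0]_(s < N) QY s.+1)); last exact: Rmult_le_compat_l.
  rewrite [X in _ <= X]mulr_suml /sum_from; apply: ler_sum => t _; case: ifP => _; first lra.
  by apply: Rmult_le_pos => //; exact: QY_ge0.
have m1 : \big[Rplus/0]_(s < N) Qm s <= c * (J0 + 4 * Lc * CY * (c * (E0 + gam ^ 2 * Z))).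
  by apply: divc; apply: Rle_trans (sum_discounted_lt r01 j0 N) jb.
have tot : sum_from s0 (fun s => QY s + Qm s) N <=
    \big[Rplus/0]_(s < N) QY s + \big[Rplus/0]_(s < N) Qm s.
  rewrite -big_split /sum_from; apply: ler_sum => t _ /=; case: ifP => _; first lra.
  by have := QY_ge0 t; have := Qm_ge0 t; lra.
rewrite /C0 /C1 -/E0 -/J0; lra.
Qed.

Let al := eta * th / 2.
Let be := / (2 * th).

Lemma merit_summable lb : (forall y, lb <= objective y) ->
  0 < gam <= 1 -> gam * (4 * C1 * Ce) <= 1 -> gam * (16 * (be * Ce * C1)) <= al ->
  gam * (16 * Lam) <= al ->
  exists C, forall R, \big[Rplus/0]_(k < R) merit g (x k) <= C.
Proof.
move=> hlb g01 g1 g2 g3.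
have [F0 hF0] := virtual_start_bound.
have hth := th_bounds; have he := eta01; have hr := r01.
have al0 : 0 < al by rewrite /al; nra.
have be0 : 0 <= be by apply: Rlt_le; apply: Rinv_0_lt_compat; lra.
have c0 : 0 < c by apply: Rinv_0_lt_compat; lra.
have hL : 0 <= 4 * Lc * CY.
  by apply: Rmult_le_pos; [have := Lc_ge0; lra | have := CY_gt0; lra].
have C10 : 0 <= C1.
  by rewrite /C1; have := Rmult_le_pos _ _ hL (Rlt_le _ _ (Rmult_lt_0_compat _ _ c0 c0)); lra.
have C00 : 0 <= C0.
  have E0 : 0 <= \big[Rplus/0]_(t < s0) sqnorm (innovation t) by apply: sumr_ge0 => t _; exact: sqnorm_ge0.
  have J0 : 0 <= \big[Rplus/0]_(t < s0) sqnorm (inj t) by apply: sumr_ge0 => t _; exact: sqnorm_ge0.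
  by have := Rmult_le_pos _ _ C10 E0; have := Rmult_le_pos _ _ (Rlt_le _ _ c0) J0; rewrite /C0 /C1; lra.
pose CA := 2 * (F0 - lb + 2 * (be * Ce * C0) + 4 * (Lam * Ce * C0)).
pose bA := / (gam * al) * CA.
exists (\big[Rplus/0]_(k < s0) merit g (x k) + Rmax 0 (2 * bA + CM * (2 * C0 + 4 * C1 * bA))) => R.
have m0 k : 0 <= merit g (x k).
  by apply: Rle_trans (Rmax_l _ _); exact: sqnorm_ge0.
case: (leqP R s0) => Rs.
  have : \big[Rplus/0]_(k < R) merit g (x k) <= \big[Rplus/0]_(k < s0) merit g (x k).
    rewrite (sum_ord_widen (fun k => merit g (x k)) Rs); apply: ler_sum => k _.
    by case: ifP => _; [lra | exact: m0].
  have := Rmax_l 0 (2 * bA + CM * (2 * C0 + 4 * C1 * bA)); lra.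
(* The horizon lies [P * B] beyond the summation range, so the descent step applies at every time
   from [s0] up to [R]. *)
pose N := (R + P * B)%nat.
pose a s := sqnorm (gradient (virtual N s)); pose q s := QY s + Qm s.
pose zz s := sqnorm (z s (act s)).
have q0 s : 0 <= q s by rewrite /q; have := QY_ge0 s; have := Qm_ge0 s; lra.
have A0 : 0 <= sum_from s0 a R.
  by apply: sumr_ge0 => t _; case: ifP => _; [exact: sqnorm_ge0 | lra].
have Q0 : 0 <= sum_from s0 q R by apply: sumr_ge0 => t _; case: ifP => _; [exact: q0 | lra].
have hZ : sum_from s0 zz R <= 2 * sum_from s0 a R + 2 * Ce * sum_from s0 q R.
  rewrite -sum_from_lin; apply: sum_from_le => t ht.
  by apply: direction_bound; rewrite /N; lia.
have hQ := error_sum_bound R.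
have hF : objective (virtual N R) <= objective (virtual N s0) +
    sum_from s0 (fun s => - (gam * al) * a s + 1 * (gam * (be * Ce) * q s + Lam * gam ^ 2 * zz s)) R.
  apply: (sum_from_telescope (u := fun s => objective (virtual N s))); first exact: ltnW.
  move=> t ht; have := @objective_step N t (proj1 g01) ltac:(lia) ltac:(rewrite /N; lia).
  rewrite -/al -/be -/(a t) -/(q t) -/(zz t); lra.
rewrite sum_from_lin (sum_from_lin s0 q zz) in hF.
have hN := hF0 N ltac:(rewrite /N; lia); have hl := hlb (virtual N R).
have [rA rQ] := @closed_loop_bound al be Ce C1 Lam C0 (F0 - lb) gam _ _ _ al0 be0 Ce_ge0 C10 Lam_ge0 C00
  g01 g1 g2 g3 A0 Q0 hZ hQ ltac:(lra).
have hbA : sum_from s0 a R <= bA.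
  have ga : 0 < gam * al by apply: Rmult_lt_0_compat; lra.
  apply: (Rmult_le_reg_l (gam * al)) => //.
  by rewrite /bA -Rmult_assoc Rinv_r ?Rmult_1_l //; lra.
have hM : \big[Rplus/0]_(k < R) merit g (x k) <= \big[Rplus/0]_(k < s0) merit g (x k) +
    sum_from s0 (fun s => 2 * a s + CM * q s) R.
  apply: (sum_le_tail (a := fun k => merit g (x k))) => // t ht.
  by apply: merit_bound; rewrite /N; lia.
apply: Rle_trans hM _; apply: Rplus_le_compat_l; apply: Rle_trans (Rmax_r _ _).
rewrite sum_from_lin.
have : CM * sum_from s0 q R <= CM * (2 * C0 + 4 * C1 * bA).
  apply: Rmult_le_compat_l; first exact: CM_ge0.
  have : C1 * sum_from s0 a R <= C1 * bA by apply: Rmult_le_compat_l.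
  lra.
lra.
Qed.

End Trajectory.

(** Only the graph, weight, delay and Lipschitz constants enter, so the step bound is chosen before
    the trajectory. With [S] dominating 1 and all coefficients, [al / S] works; since [al < 1], the
    conditions with right-hand side 1 follow too. *)
Lemma exists_step_bound : exists gbar, 0 < gbar /\ forall gam, 0 < gam < gbar ->
  let C1 := / (1 - r) + 4 * Lc * CY * (/ (1 - r) * / (1 - r)) in
  0 < gam <= 1 /\ gam * (4 * C1 * Ce) <= 1 /\
  gam * (16 * (/ (2 * th) * Ce * C1)) <= eta * th / 2 /\ gam * (16 * Lam) <= eta * th / 2.
Proof.
set C1 := _ + _; have hth := th_bounds; have he := eta01.
set al := eta * th / 2; have al0 : 0 < al by rewrite /al; nra.
pose S := 1 + Rabs (4 * C1 * Ce) + Rabs (16 * (/ (2 * th) * Ce * C1)) + Rabs (16 * Lam).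
have S1 : 1 <= S.
  rewrite /S; have := Rabs_pos (4 * C1 * Ce); have := Rabs_pos (16 * (/ (2 * th) * Ce * C1)).
  have := Rabs_pos (16 * Lam); lra.
have al1 : al < 1 by rewrite /al; nra.
exists (al / S); split; first by apply: Rdiv_lt_0_compat; lra.
move=> gam hg /=.
have gS : gam * S < al.
  have e : al / S * S = al by field; lra.
  by rewrite -e; apply: Rmult_lt_compat_r; lra.
have small t : Rabs t <= S -> gam * t <= al.
  move=> h; have := Rle_abs t => h'.
  apply: (Rle_trans _ (gam * S)); last lra.
  by apply: Rmult_le_compat_l; lra.
have p1 := Rabs_pos (4 * C1 * Ce); have p2 := Rabs_pos (16 * (/ (2 * th) * Ce * C1)).
have p3 := Rabs_pos (16 * Lam).
have h1 := small (4 * C1 * Ce) ltac:(rewrite /S; lra).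
have h2 := small (16 * (/ (2 * th) * Ce * C1)) ltac:(rewrite /S; lra).
have h3 := small (16 * Lam) ltac:(rewrite /S; lra).
repeat split; try lra; nra.
Qed.

End Convergence.

Theorem theorem3 (n I : nat) (E : rel 'I_I) (W A : 'I_I -> 'I_I -> R) (mbar : R)
  (T D : nat) (f : 'I_I -> vec n -> R) (g : 'I_I -> vec n -> vec n) (L : 'I_I -> R) :
  (0 < I)%nat ->
  strongly_connected E -> no_self_loops E ->
  0 < mbar < 1 ->
  row_stochastic W -> weight_pattern E mbar W ->
  col_stochastic A -> weight_pattern E mbar A ->
  (forall i, lipschitz_differentiable (f i) (g i) (L i)) ->
  (exists lb : R, forall y : vec n, lb <= \big[Rplus/0]_(i < I) f i y) ->
  exists gbar2 : R, 0 < gbar2 /\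
    forall gam : R, 0 < gam < gbar2 ->
    forall (act : nat -> 'I_I) (d : nat -> 'I_I -> nat),
      asynchrony_model E T D act d ->
    forall (x z : nat -> 'I_I -> vec n) (v : Z -> 'I_I -> vec n)
           (rho : Z -> 'I_I -> 'I_I -> vec n) (rt : nat -> 'I_I -> 'I_I -> vec n)
           (tau : nat -> 'I_I -> 'I_I -> Z),
      asy_sonata E W A D g gam act d x z v rho rt tau ->
      exists C : R, forall delta : R, 0 < delta ->
        exists Tdelta : nat,
          first_hit (fun k => merit g (x k)) delta Tdelta /\ INR Tdelta <= C / delta.
Proof.
move=> _ sc nsl mb01 Wrow Wpat Acol Apat Lip [lb hlb].
(* For [T = 0] the activation windows are empty, so the asynchrony model is contradictory and any
   step bound will do. *)
case: (posnP T) => [T0|T0].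
  exists 1; split; first lra.
  by move=> gam _ act d async; have := T_gt0 async; rewrite T0.
have [P EP] := bounded_reach sc.
have [gbar [gbar0 hgbar]] := exists_step_bound D P L mb01 T0.
exists gbar; split=> // gam /hgbar [g01 [g1 [g2 g3]]] act d async x z v rho rt tau alg.
have [C hC] := merit_summable nsl mb01 Wrow Wpat Acol Apat Lip EP T0 async alg hlb g01 g1 g2 g3.
exists C => delta d0.
have m0 k : 0 <= merit g (x k) by apply: Rle_trans (Rmax_l _ _); exact: sqnorm_ge0.
by have [k h1 h2] := first_hit_of_summable m0 hC d0; exists k.
Qed.
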